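(* Let $n\ge3$, $G=SO(n,1)$, and let $\Gamma\subset G$ be a cocompact lattice such that the Laplace–Beltrami operator $\Delta$ on $SO(n)\backslash G/\Gamma$ has eigenvalues in $(0,\frac14)$. Let $X=G/\Gamma$ with Haar probability measure $\mu$ and let $U\in\mathfrak{so}(n,1)$ be a nonzero nilpotent element. Then there is a time-change of the unipotent flow on $X$ that is not measurably conjugate to the unperturbed unipotent flow: there is a positive integrable function $\tau$ on $X$ with $\int_X\tau\,d\mu=1$ such that there is no measurable conjugacy map $\psi:(X,\mu)\to(X,\mu_\tau)$ with $\psi(\phi^U_t(x))=\phi^{U,\tau}_t(\psi(x))$ for $t\in\mathbf{R}$ and $\mu$-a.e. $x\in X$.
   Context: $SO(n,1)\subset SL_{n+1}(\mathbf{R})$ preserves $\mathrm{diag}(I_n,-1)$. $\phi^U_t(x)=u^tx=\exp(tU)x$. For positive integrable $\tau$ with $\int_X\tau\,d\mu=1$, put $\xi(x,t)=\int_0^t\tau(u^sx)\,ds$; the time change $\phi^{U,\tau}_t$ of $\phi^U_t$ is defined by $\phi^{U,\tau}_{\xi(x,t)}(x)=u^tx$; it preserves $d\mu_\tau=\tau\,d\mu$. A measurable conjugacy map is an isomorphism of measure spaces (invertible mod null sets, bimeasurable, measure preserving) intertwining the flows. $\Delta$ is the action of $-\sum_kY_k^2-\sum_{i<j}\Theta_{ij}^2$, where $Y_k=\begin{pmatrix}0 & e_k \\ e_k^T & 0\end{pmatrix}$ and $\Theta_{ij}=\begin{pmatrix}E_{ji}-E_{ij} & 0 \\ 0 & 0\end{pmatrix}$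 form a basis of $\mathfrak{so}(n,1)$, on $SO(n)$-invariant functions in $L^2(G/\Gamma)$. *)

(* Defs.v *)
From HB Require Import structures.
From mathcomp Require Import all_boot all_order all_algebra.
From mathcomp Require Import generic_quotient.
From mathcomp Require Import all_classical all_reals all_analysis.

Set Implicit Arguments.
Unset Strict Implicit.
Unset Printing Implicit Defensive.

Import Order.TTheory GRing.Theory Num.Theory.
Import numFieldNormedType.Exports.

Local Open Scope classical_set_scope.
Local Open Scope ring_scope.
Local Open Scope quotient_scope.

Definition Jmx (R : realType) (n : nat) : 'M[R]_(n + 1) :=
  block_mx 1%:M 0 0 (- 1%:M).

Definition SOn1_set (R : realType) (n : nat) : set 'M[R]_(n + 1) :=
  [set A | A^T *m Jmx R n *m A = Jmx R n /\ \det A = 1].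

(* The full group SO(n,1), with both of its connected components. *)
Definition SOn1 (R : realType) (n : nat) : Type := SOn1_set (R := R) (n := n).

HB.instance Definition _ (R : realType) (n : nat) :=
  SubChoice.on (SOn1 R n).
HB.instance Definition _ (R : realType) (n : nat) :=
  Topological.copy (SOn1 R n) (SOn1_set (R := R) (n := n)).

Section SOn1_group.
Variables (R : realType) (n : nat).
Local Notation J := (Jmx R n).
Local Notation G := (SOn1 R n).

Lemma SOn1P (g : G) : SOn1_set (\val g).
Proof. exact: set_mem (valP g). Qed.

Lemma SOn1_unit (g : G) : \val g \in unitmx.
Proof. by rewrite unitmxE (SOn1P g).2 unitr1. Qed.

Fact SOn1_set1 : (1%:M : 'M[R]_(n + 1)) \in SOn1_set (R := R) (n := n).
Proof. by rewrite inE /SOn1_set /= trmx1 mul1mx mulmx1 det1. Qed.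

Fact SOn1_setM (g h : G) :
  (\val g *m \val h) \in SOn1_set (R := R) (n := n).
Proof.
have [gJ dg] := SOn1P g; have [hJ dh] := SOn1P h.
rewrite inE; split; last by rewrite det_mulmx dg dh mulr1.
by rewrite trmx_mul -mulmxA mulmxA -!mulmxA !mulmxA -(mulmxA _ _ J)
           -(mulmxA _ (_ *m J)) gJ hJ.
Qed.

Fact SOn1_setV (g : G) : invmx (\val g) \in SOn1_set (R := R) (n := n).
Proof.
have [gJ dg] := SOn1P g; have gU := SOn1_unit g.
rewrite inE; split; last by rewrite det_inv dg invr1.
by rewrite -[in LHS]gJ trmx_inv !mulmxA mulVmx ?unitmx_tr// mul1mx
           -mulmxA mulmxV// mulmx1.
Qed.

Definition SOn1_one : G := Sub 1%:M SOn1_set1.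
Definition SOn1_mul (g h : G) : G := Sub (\val g *m \val h) (SOn1_setM g h).
Definition SOn1_inv (g : G) : G := Sub (invmx (\val g)) (SOn1_setV g).

Fact SOn1_mulA : associative SOn1_mul.
Proof. by move=> g h k; apply: val_inj; rewrite /= mulmxA. Qed.
Fact SOn1_mul1g : left_id SOn1_one SOn1_mul.
Proof. by move=> g; apply: val_inj; rewrite /= mul1mx. Qed.
Fact SOn1_mulg1 : right_id SOn1_one SOn1_mul.
Proof. by move=> g; apply: val_inj; rewrite /= mulmx1. Qed.
Fact SOn1_mulVg : left_inverse SOn1_one SOn1_inv SOn1_mul.
Proof. by move=> g; apply: val_inj; rewrite /= mulVmx// SOn1_unit. Qed.
Fact SOn1_mulgV : right_inverse SOn1_one SOn1_inv SOn1_mul.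
Proof. by move=> g; apply: val_inj; rewrite /= mulmxV// SOn1_unit. Qed.

HB.instance Definition _ := isGroup.Build G
  SOn1_mulA SOn1_mul1g SOn1_mulg1 SOn1_mulVg SOn1_mulgV.
HB.instance Definition _ := isPointed.Build G (1%g : G).

End SOn1_group.

Section homogeneous_space.
Variables (R : realType) (n : nat) (Gam : set (SOn1 R n)).
Local Notation G := (SOn1 R n).

(* g ~ h iff g Gam = h Gam; an equivalence relation whatever Gam is, so that
   the quotient type needs no proof that Gam is a subgroup. *)
Definition coset_eq (g h : G) : bool :=
  `[< [set (g * c)%g | c in Gam] = [set (h * c)%g | c in Gam] >].

Fact coset_eq_refl : reflexive coset_eq.
Proof. by move=> g; apply/asboolP. Qed.
Fact coset_eq_sym : symmetric coset_eq.
Proof. by move=> g h; apply/asboolP/asboolP. Qed.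
Fact coset_eq_trans : transitive coset_eq.
Proof. by move=> h g k /asboolP gh /asboolP hk; apply/asboolP; rewrite gh. Qed.

Canonical coset_eqR :=
  EquivRel coset_eq coset_eq_refl coset_eq_sym coset_eq_trans.

(* G/Gam with the quotient topology and its Borel sigma-algebra *)
Definition homog : Type := quotient_topology {eq_quot coset_eqR}.

HB.instance Definition _ :=
  Quotient.copy homog (quotient_topology {eq_quot coset_eqR}).
HB.instance Definition _ :=
  PointedTopological.copy homog (quotient_topology {eq_quot coset_eqR}).
HB.instance Definition _ := Measurable.copy homog
  (g_sigma_algebraType (@open (quotient_topology {eq_quot coset_eqR}))).

Definition gact (g : G) (x : homog) : homog := \pi_homog (g * repr x)%g.

Definition invariant_measure (mu : set homog -> \bar R) : Prop :=
  forall (g : G) (A : set homog), measurable A -> mu (gact g @^-1` A) = mu A.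

Definition is_lattice : Prop :=
  [/\ group_closed (mem Gam),
      isolated Gam = Gam
    & exists mu : probability homog R, invariant_measure mu].

Definition is_cocompact_lattice : Prop :=
  is_lattice /\ compact [set: homog].

End homogeneous_space.

Section lie_algebra.
Variables (R : realType) (n : nat).
Local Notation M := 'M[R]_(n + 1).

Definition son1 : set M := [set A | A^T *m Jmx R n + Jmx R n *m A = 0].

Definition nilpotent_mx (A : M) : Prop := exists k : nat, A ^+ k = 0.

Definition expm (A : M) : M :=
  limn (series (fun k : nat => (k`!%:R)^-1 *: A ^+ k)).

(* [expm A] lies in SO(n,1) for A in so(n,1); the default value 1 is only
   reached outside the Lie algebra. *)
Definition gexp (A : M) : SOn1 R n := insubd (1%g : SOn1 R n) (expm A).

Definition Ymx (k : 'I_n) : M :=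
  block_mx 0 (delta_mx k 0) (delta_mx 0 k) 0.

Definition Thmx (i j : 'I_n) : M :=
  block_mx (delta_mx j i - delta_mx i j) 0 0 0.

Definition SOn : set (SOn1 R n) :=
  [set g | exists B : 'M[R]_n,
     [/\ B^T *m B = 1%:M, \det B = 1 & \val g = block_mx B 0 0 1%:M]].

End lie_algebra.
Arguments SOn : clear implicits.
Arguments son1 : clear implicits.

Section laplacian.
Variables (R : realType) (n : nat) (Gam : set (SOn1 R n)).
Variable mu : {measure set (homog Gam) -> \bar R}.
Local Notation X := (homog Gam).

(* g is the derivative at t = 0, in L^2(mu), of t |-> f (exp(tA) x); only
   second order derivatives are used below, so the sign in the action of G on
   functions is immaterial. *)
Definition L2_lie_derivative (A : 'M[R]_(n + 1)) (f g : X -> R) : Prop :=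
  [/\ f \in Lfun mu 2%:E, g \in Lfun mu 2%:E
    & ('N[mu]_(2%:E)[EFin \o
         (fun x => t^-1 * (f (gact (gexp (t *: A)) x) - f x) - g x)%R])%E
      @[t --> (0 : R)^'] --> 0%E].

(* f is in the domain of Delta and Delta f = g *)
Definition is_laplacian (f g : X -> R) : Prop :=
  exists (Yf YYf : 'I_n -> X -> R) (Tf TTf : 'I_n -> 'I_n -> X -> R),
    [/\ forall k, L2_lie_derivative (Ymx R k) f (Yf k)
                  /\ L2_lie_derivative (Ymx R k) (Yf k) (YYf k),
        forall i j : 'I_n, (i < j)%N ->
          L2_lie_derivative (Thmx R i j) f (Tf i j)
          /\ L2_lie_derivative (Thmx R i j) (Tf i j) (TTf i j)
      & {ae mu, forall x, g x = - (\sum_(k < n) YYf k x)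
          - \sum_(i < n) \sum_(j < n | (i < j)%N) TTf i j x}].

Definition SOn_invariant (f : X -> R) : Prop :=
  forall k, SOn R n k -> {ae mu, forall x, f (gact k x) = f x}.

Definition laplace_eigenvalue (lam : R) : Prop :=
  exists f : X -> R,
    [/\ f \in Lfun mu 2%:E, ~ {ae mu, forall x, f x = 0}, SOn_invariant f
      & is_laplacian f (fun x => lam * f x)].

End laplacian.

Section time_change.
Variables (R : realType) (n : nat) (Gam : set (SOn1 R n)).
Local Notation X := (homog Gam).

Definition flow (U : 'M[R]_(n + 1)) (t : R) (x : X) : X :=
  gact (gexp (t *: U)) x.

(* \int_0^t tau (u^s x) ds, oriented when t < 0 *)
Definition xi (U : 'M[R]_(n + 1)) (tau : X -> R) (x : X) (t : R) : R :=
  if 0 <= t then \int[lebesgue_measure]_(s in `[0, t]) tau (flow U s x)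
  else - \int[lebesgue_measure]_(s in `[t, 0]) tau (flow U s x).

(* At time s, flow along U for the time t such that xi x t = s. *)
Definition time_change (U : 'M[R]_(n + 1)) (tau : X -> R) (s : R) (x : X) : X :=
  flow U (xget 0 [set t | xi U tau x t = s]) x.

Lemma time_change_xi (U : 'M[R]_(n + 1)) (tau : X -> R) (x : X) (t : R) :
  injective (xi U tau x) -> time_change U tau (xi U tau x t) x = flow U t x.
Proof.
move=> inj; rewrite /time_change; congr (flow U _ x).
by case: xgetP => [s _ /= /inj //|/(_ t)]; case.
Qed.

Definition time_change_measure (mu : {measure set X -> \bar R}) (tau : X -> R)
  : set X -> \bar R := fun A => (\int[mu]_(x in A) (tau x)%:E)%E.

End time_change.

Definition measure_space_iso (R : realType) (d1 d2 : measure_display)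
    (T1 : measurableType d1) (T2 : measurableType d2)
    (m1 : set T1 -> \bar R) (m2 : set T2 -> \bar R) (psi : T1 -> T2) : Prop :=
  [/\ measurable_fun setT psi,
      forall A, measurable A -> m1 (psi @^-1` A) = m2 A
    & exists psi' : T2 -> T1,
        [/\ measurable_fun setT psi',
            {ae m1, forall x, psi' (psi x) = x}
          & {ae m2, forall y, psi (psi' y) = y}]].

(* psi conjugates the flow phi1 on (T1, m1) to the flow phi2 on (T2, m2). *)
Definition measurable_conjugacy (R : realType) (d1 d2 : measure_display)
    (T1 : measurableType d1) (T2 : measurableType d2)
    (m1 : set T1 -> \bar R) (m2 : set T2 -> \bar R)
    (phi1 : R -> T1 -> T1) (phi2 : R -> T2 -> T2) (psi : T1 -> T2) : Prop :=
  measure_space_iso m1 m2 psi /\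
  forall t : R, {ae m1, forall x, psi (phi1 t x) = phi2 t (psi x)}.

(* Main.v *)
Require Import Defs.
From mathcomp Require Import all_boot all_order all_algebra generic_quotient.
From mathcomp Require Import ring lra zify.
From mathcomp Require Import all_classical all_reals all_analysis measurable_realfun.

Import Order.TTheory GRing.Theory Num.Theory.
Import numFieldNormedType.Exports.
Local Open Scope classical_set_scope.
Local Open Scope ring_scope.

(* As [tau] only has to be positive and integrable, it can be chosen so wild that
   the time change acquires an eigenvalue, whatever the spectrum of [Delta].
   Take a local cross-section [S] of the unipotent flow and let [tau] be, up to a
   constant, the inverse of the length of the current excursion from [S].  In
   [tau]-time all excursions have the same length [2 h], so on the invariant set
   [Y] of points recurrent to [S] the time-[h] map of the time change swaps the
   set [B] of points in the first half of their excursion with [Y `\` B].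

   The unipotent flow [u^t] itself has no such swap [C <-> Z `\` C] with
   [mu Z > 0].  Indeed some [a_k -> 1] in [SO(n,1)] satisfy
   [a_k u^t = u^((2k+3)/(2k+2) t) a_k], so the preimage [C_k] of [C] under [a_k] is
   swapped by time [(2k+2)/(2k+3) h].  At time [(2k+2) h] the set [C] is back to
   itself while [C_k] is moved to its complement in the preimage of [Z];
   hence [mu (C `&` C_k) <= mu (C `\` C_k)], which tends to [0] as [a_k -> 1]. *)

(** * The Lorentz form and nilpotent elements of so(n,1) *)

Section lorentz_form.
Context {R : realType} {n : nat}.
Local Notation J := (Jmx R n).
Local Notation V := 'cV[R]_(n + 1).

Definition lform (x y : V) : R := (x^T *m J *m y) 0 0.

Lemma lformDl (x y z : V) : lform (x + y) z = lform x z + lform y z.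
Proof. by rewrite /lform raddfD /= !mulmxDl mxE. Qed.

Lemma lformZl a (x z : V) : lform (a *: x) z = a * lform x z.
Proof. by rewrite /lform linearZ /= -!scalemxAl mxE. Qed.

Lemma trmx_J : J^T = J.
Proof. by rewrite /Jmx tr_block_mx !trmx0 trmx1 raddfN /= trmx1. Qed.

Lemma mulJJ : J *m J = 1%:M.
Proof.
by rewrite /Jmx mulmx_block !(mulmx0, mul0mx, mulmx1, mulmxN, mulNmx, addr0, add0r, opprK)
  scalar_mx_block.
Qed.

Lemma lformC (x y : V) : lform x y = lform y x.
Proof.
transitivity ((x^T *m J *m y)^T 0 0); first by rewrite mxE.
by rewrite !trmx_mul trmx_J trmxK mulmxA.
Qed.

Lemma lformDr (x y z : V) : lform z (x + y) = lform z x + lform z y.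
Proof. by rewrite lformC lformDl !(lformC _ z). Qed.

Lemma lformZr a (x z : V) : lform z (a *: x) = a * lform z x.
Proof. by rewrite lformC lformZl lformC. Qed.

Lemma lformBl (x y z : V) : lform (x - y) z = lform x z - lform y z.
Proof. by rewrite -scaleN1r lformDl lformZl mulN1r. Qed.

Lemma lform0r (x : V) : lform x 0 = 0.
Proof. by rewrite /lform mulmx0 mxE. Qed.

Lemma lform_nondegenerate (x : V) : (forall y, lform x y = 0) -> x = 0.
Proof.
move=> x0; suff xJ0 : x^T *m J = 0.
  by rewrite -[x]trmxK -[x^T]mulmx1 -mulJJ mulmxA xJ0 mul0mx trmx0.
apply/rowP => j; have := x0 (delta_mx j 0).
by rewrite /lform -colE !mxE => ->.
Qed.

Lemma lform_coordE (x : V) : lform x x =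
  \sum_(i < n) (usubmx x i 0) ^+ 2 - (dsubmx x 0 0) ^+ 2.
Proof.
rewrite /lform -[x]vsubmxK tr_col_mx /Jmx mul_row_block.
rewrite !(mulmx0, mulmx1, mulmxN, addr0, add0r) mul_row_col mulNmx col_mxKu col_mxKd.
rewrite !mxE big_ord1 !mxE expr2; congr (_ - _).
by apply: eq_bigr => i _; rewrite !mxE expr2.
Qed.

(** On the hyperplane of vanishing last coordinate the form is the Euclidean square norm, hence
    positive definite. *)
Lemma lform_spacelike (x : V) : dsubmx x 0 0 = 0 ->
  0 <= lform x x /\ (lform x x = 0 -> x = 0).
Proof.
move=> x0; rewrite lform_coordE x0 expr0n subr0; split.
  by apply: sumr_ge0 => i _; exact: sqr_ge0.
move=> /psumr_eq0P s0; rewrite -[x]vsubmxK -[RHS]vsubmxK; congr col_mx.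
  rewrite raddf0; apply/colP => i; rewrite [RHS]mxE; apply/eqP.
  by rewrite -sqrf_eq0 s0// => j _; exact: sqr_ge0.
by rewrite raddf0; apply/colP => i; rewrite ord1 [RHS]mxE.
Qed.

(* Subtract from [v] the multiple of [t] that kills its last coordinate. *)
Lemma lform_null_orth (t v : V) : t != 0 -> lform t t = 0 -> lform v t = 0 ->
  0 <= lform v v /\ (lform v v = 0 -> exists c, v = c *: t).
Proof.
move=> t_neq0 tt vt.
have t0 : dsubmx t 0 0 != 0.
  by apply: contra_neq t_neq0 => /lform_spacelike[_ ->].
pose c := - (dsubmx v 0 0 / dsubmx t 0 0).
have v0 : dsubmx (v + c *: t) 0 0 = 0.
  by move: t0; rewrite /c !mxE => t0; rewrite mulNr divfK// subrr.
have vv : lform (v + c *: t) (v + c *: t) = lform v v.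
  by rewrite !(lformDl, lformDr, lformZl, lformZr) (lformC t v) vt tt; ring.
have := lform_spacelike _ v0; rewrite vv => -[ge0 eq0]; split=> // /eq0.
by move=> /eqP; rewrite addr_eq0 => /eqP vE; exists (- c); rewrite scaleNr -vE.
Qed.

Lemma mulmx_col_inj (A B : 'M[R]_(n + 1)) :
  (forall y : V, A *m y = B *m y) -> A = B.
Proof.
move=> AB; apply/matrixP => i j.
by have /colP/(_ i) := AB (delta_mx j 0); rewrite -!colE !mxE.
Qed.

Lemma lform_mx (x y : V) : x^T *m J *m y = (lform x y)%:M.
Proof. exact: mx11_scalar. Qed.

Section skew.
Variable U : 'M[R]_(n + 1).
Hypothesis hU : son1 R n U.

Lemma lform_skew (x y : V) : lform (U *m x) y = - lform x (U *m y).
Proof.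
move: hU; rewrite /son1 /= => /eqP; rewrite addr_eq0 => /eqP UJ.
by rewrite /lform trmx_mul -(mulmxA _ U^T) UJ mulmxN mulNmx [LHS]mxE !mulmxA.
Qed.

Lemma lform_skew0 (x : V) : lform x (U *m x) = 0.
Proof.
have := lform_skew x x; rewrite lformC => /eqP.
by rewrite -addr_eq0 -mulr2n mulrn_eq0 /= => /eqP.
Qed.

(** Skewness makes the image of [U] totally isotropic, hence, in Lorentz signature, contained in a
    null line spanned by some [t = U *m x]. If [y] is not orthogonal to [t], then
    [lform y (U *m y) = 0] forces [U *m y = 0]; applied to [y] and to [x + y] this gives [t = 0]. *)
Lemma skew_sqr0 : U *m U = 0 -> U = 0.
Proof.
move=> UU.
have null x y : lform (U *m x) (U *m y) = 0.
  by rewrite lform_skew mulmxA UU mul0mx lform0r oppr0.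
apply/eqP/negP => /negP U0.
have [x xU] : exists x : V, U *m x != 0.
  apply: contrapT => /forallNP H; move/eqP: U0; apply; apply/matrixP => i j.
  have /negP/negPn/eqP /colP/(_ i) := H (delta_mx j 0).
  by rewrite -colE !mxE.
set t := U *m x in xU *.
have Ut y : exists c, U *m y = c *: t.
  by have [_] := lform_null_orth t (U *m y) xU (null _ _) (null _ _); apply.
have tx : lform t x = 0 by rewrite lformC lform_skew0.
have Uy y : lform t y != 0 -> U *m y = 0.
  move=> ty; have [c cE] := Ut y; have := lform_skew0 y.
  rewrite cE lformZr (lformC y) => /eqP; rewrite mulf_eq0 (negPf ty) orbF.
  by move=> /eqP ->; rewrite scale0r.
have : t = 0.
  apply: lform_nondegenerate => y; apply/eqP/negPn/negP => ty.
  have /Uy : lform t (x + y) != 0 by rewrite lformDr tx add0r.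
  by rewrite mulmxDr (Uy _ ty) addr0 => t0; rewrite /t t0 eqxx in xU.
by move=> t0; rewrite t0 eqxx in xU.
Qed.

End skew.

(** Moving [U] past [J] changes its sign, so [U ^+ k] picks up [(-1) ^+ k]. This makes [skew_sqr0]
    available for odd powers. *)
Lemma son1_odd_pow (U : 'M[R]_(n + 1)) k : odd k ->
  son1 R n U -> son1 R n (U ^+ k).
Proof.
rewrite /son1 /= => ok /eqP; rewrite addr_eq0 => /eqP UJ.
have E m : (U ^+ m)^T *m J = (-1) ^+ m *: (J *m U ^+ m).
  elim: m => [|m IH]; first by rewrite expr0 trmx1 mul1mx mulmx1 scale1r.
  rewrite [in LHS]exprS -mulmxE trmx_mul -mulmxA UJ mulmxN mulmxA IH -scalemxAl.
  by rewrite -mulmxA mulmxE -exprSr [(-1) ^+ m.+1]exprS mulN1r scaleNr.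
by rewrite E -signr_odd ok expr1 scaleN1r addNr.
Qed.

(** If the nilpotency index [k] exceeded 3, one of [k - 2] and [k - 1] would be an odd [m < k] with
    [2 m >= k]; then [U ^+ m] is skew with square zero, so it vanishes, against the minimality of
    [k]. *)
Lemma son1_nilpotent_cube (U : 'M[R]_(n + 1)) :
  son1 R n U -> nilpotent_mx U -> U ^+ 3 = 0.
Proof.
move=> hU [k0 k0P].
have ex : exists k, U ^+ k == 0 by exists k0; apply/eqP.
case: (ex_minnP ex) => k /eqP Uk kmin.
have [|k4] := leqP k 3.
  by move=> k3; rewrite -(subnK k3) exprD Uk mulr0.
have sq m : odd m -> (k <= m + m)%N -> (k <= m)%N.
  move=> om km; apply: kmin; apply/eqP; apply: skew_sqr0.
    exact: son1_odd_pow.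
  by rewrite mulmxE -exprD -(subnK km) exprD Uk mulr0.
have [ok|ok] := boolP (odd k).
  have : (k <= k - 2)%N by apply: sq; [rewrite oddB ?ok//; lia|lia].
  lia.
have : (k <= k - 1)%N by apply: sq; [rewrite oddB ?(negPf ok)//; lia|lia].
lia.
Qed.

(* For [U] conjugate to the standard horospherical element, [P] and [Q] project
   onto the null eigenlines of a semisimple element [H = P - Q] with
   [[H, U] = U]. *)
Lemma son1_nilpotent_grading (U : 'M[R]_(n + 1)) :
  son1 R n U -> nilpotent_mx U -> U != 0 ->
  exists P Q : 'M[R]_(n + 1),
    [/\ [/\ P *m P = P, Q *m Q = Q, P *m Q = 0 & Q *m P = 0],
        P^T *m J = J *m Q, U *m P = 0, Q *m U = 0
      & P *m U + U *m Q = U].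
Proof.
move=> hU Unil U0.
have U3 : U *m U *m U = 0.
  by rewrite !mulmxE -expr2 -exprSr; exact: son1_nilpotent_cube.
have U3v (x : V) : U *m (U *m (U *m x)) = 0 by rewrite !mulmxA U3 !mul0mx.
have skew := lform_skew U hU; have skew0 := lform_skew0 U hU.
(* Otherwise polarization makes [lform (U *m (U *m x)) y] vanish identically, so that [U *m U = 0],
   and [U = 0] by [skew_sqr0]. *)
have [x xUU] : exists x : V, lform x (U *m (U *m x)) != 0.
  apply: contrapT => /forallNP H; move/eqP: U0; apply.
  apply: skew_sqr0 => //.
  have {}H x : lform x (U *m (U *m x)) = 0.
    by apply/eqP/negPn/negP; exact: H.
  have Hxy x y : lform (U *m (U *m x)) y = 0.
    have := H (x + y); rewrite !mulmxDr !(lformDl, lformDr) !H add0r addr0.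
    rewrite (lformC y) -[lform x (U *m _)]opprK -skew -[lform (U *m x) _]opprK.
    rewrite -[lform (U *m x) _]opprK -skew !opprK lformC => /eqP.
    by rewrite -mulr2n mulrn_eq0 => /eqP.
  apply/matrixP => i j; rewrite [RHS]mxE.
  have /colP/(_ i) := lform_nondegenerate _ (Hxy (delta_mx j 0)).
  by rewrite mulmxA -colE !mxE.
(* The constant [c] makes [e] null. The vectors [e], [w = U *m e] and [l = U *m w] span a
   nondegenerate [U]-invariant subspace: [e] and [l] are null with product [b], and [w] is
   orthogonal to both with square [- b]. The next steps show that [U] vanishes on the orthogonal
   complement. *)
pose b := lform x (U *m (U *m x)).
pose c := - lform x x / (2 * b).
pose l := U *m (U *m x).
pose e := x + c *: l; pose w := U *m e.
have Ul : U *m l = 0 by exact: U3v.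
have Ue : U *m e = U *m x by rewrite mulmxDr -scalemxAr Ul scaler0 addr0.
have Uw : U *m w = l by rewrite /w Ue.
have ll : lform l l = 0 by rewrite {1}/l skew Ul lform0r oppr0.
have ee : lform e e = 0.
  rewrite !(lformDl, lformDr, lformZl, lformZr) ll (lformC l) -/b /c.
  by field; exact: xUU.
have el : lform e l = b by rewrite lformDl lformZl ll mulr0 addr0.
have ew : lform e w = 0 by exact: skew0.
have wl : lform w l = 0 by rewrite -Uw skew0.
have ww : lform w w = - b by rewrite /w skew Uw el.
(* Orthogonality to [l] makes a null [z] a multiple of [l], and [lform e l = b != 0] makes that
   multiple zero. *)
have orth0 z : lform z e = 0 -> lform z l = 0 -> lform z z = 0 -> z = 0.
  move=> ze zl zz.
  have l0 : l != 0 by apply: contra_neq xUU; rewrite -/l => ->; rewrite lform0r.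
  have [_ /(_ zz)[a zE]] := lform_null_orth l z l0 ll zl.
  move: ze => /eqP; rewrite zE lformZl lformC el mulf_eq0 (negPf xUU) orbF.
  by move=> /eqP ->; rewrite scale0r.
have orth z : lform z e = 0 -> lform z w = 0 -> lform z l = 0 -> U *m z = 0.
  move=> ze zw zl.
  have U1 : lform (U *m z) e = 0 by rewrite skew -/w zw oppr0.
  have U1l : lform (U *m z) l = 0 by rewrite skew Ul lform0r oppr0.
  have U2 : U *m (U *m z) = 0.
    apply: orth0; first by rewrite !skew -/w Uw zl !oppr0.
      by rewrite !skew Ul mulmx0 lform0r !oppr0.
    by rewrite !skew U3v lform0r !oppr0.
  by apply: orth0 => //; rewrite skew U2 lform0r oppr0.
(* The difference [z] of the two sides is orthogonal to [e], [w] and [l], so [U *m z = 0]; this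
   makes [z] null, and then zero. *)
have UE y : U *m y = - b^-1 *: (lform y w *: l - lform y l *: w).
  apply/eqP; rewrite -subr_eq0; apply/eqP; set z := _ - _.
  have ze : lform z e = 0.
    rewrite lformBl lformZl lformBl !lformZl skew -/w (lformC l) el (lformC w) ew.
    by field; exact: xUU.
  have zw : lform z w = 0.
    rewrite lformBl lformZl lformBl !lformZl skew Uw ww (lformC l) wl.
    by field; exact: xUU.
  have zl : lform z l = 0.
    rewrite lformBl lformZl lformBl !lformZl skew Ul lform0r ll wl.
    by ring.
  have Uz := orth z ze zw zl.
  apply: orth0 => //.
  rewrite {1}/z lformBl lformZl lformBl !lformZl skew Uz lform0r.
  by rewrite (lformC l) zl (lformC w) zw; ring.
have b0 : b != 0 by [].
have Uew : U *m e = w by [].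
clear orth orth0 ww; clearbody w; clearbody e; clear c; clearbody l b.
(* The functionals [p] and [q] read off the coefficients along [l] and [e], so [l *m p] and [e *m q]
   are the projections onto these two null lines. *)
pose p := b^-1 *: (e^T *m J); pose q := b^-1 *: (l^T *m J).
have pE y : p *m y = (b^-1 * lform e y)%:M.
  by rewrite /p -scalemxAl lform_mx scale_scalar_mx.
have qE y : q *m y = (b^-1 * lform l y)%:M.
  by rewrite /q -scalemxAl lform_mx scale_scalar_mx.
exists (l *m p), (e *m q); split; [split| | | |].
- by rewrite mulmxA -(mulmxA l) pE el mulVf// mulmx1.
- by rewrite mulmxA -(mulmxA e) qE lformC el mulVf// mulmx1.
- by rewrite mulmxA -(mulmxA l) pE ee mulr0 raddf0 mulmx0 mul0mx.
- by rewrite mulmxA -(mulmxA e) qE ll mulr0 raddf0 mulmx0 mul0mx.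
- rewrite /p /q -!scalemxAr linearZ /= -scalemxAl !trmx_mul trmx_J trmxK.
  by rewrite !mulmxA.
- by rewrite mulmxA Ul mul0mx.
- apply: mulmx_col_inj => y; rewrite -!mulmxA qE -lformC skew Ul.
  by rewrite lform0r oppr0 mulr0 raddf0 mulmx0 mul0mx.
- apply: mulmx_col_inj => y; rewrite mulmxDl -!mulmxA pE qE.
  rewrite !mul_mx_scalar -scalemxAr (lformC e) skew !Uew (lformC l) [RHS]UE.
  by rewrite scalerBr !scalerA mulrN !mulNr !scaleNr opprK.
Qed.
End lorentz_form.

(** * Topology and one-parameter subgroups of SO(n,1) *)

Section matrix_topology.
Context {R : realType} {m n : nat}.

Lemma hausdorff_mx : hausdorff_space 'M[R]_(m, n).
Proof.
move=> p q pq; apply/matrixP => i j; apply: norm_hausdorff => A B pA qB.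
have [M [AM BM]] := pq _ _ (@coord_continuous R m n i j p A pA)
  (@coord_continuous R m n i j q B qB).
by exists (M i j).
Qed.

Lemma cvg_mx {T : Type} (F : set_system T) {FF : Filter F} (f : T -> 'M[R]_(m, n))
    (M : 'M[R]_(m, n)) :
  (forall i j, f x i j @[x --> F] --> M i j) -> f x @[x --> F] --> M.
Proof.
move=> cf A [P PM PA].
have : \forall x \near F, forall ij : 'I_m * 'I_n, P ij.1 ij.2 (f x ij.1 ij.2).
  by apply: filter_forall => -[i j]; exact: cf (PM i j).
by apply: filterS => x Px; apply: PA => i j; exact: Px (i, j).
Qed.

End matrix_topology.

Lemma cvg_coord {R : realType} {m n : nat} {T : Type} (F : set_system T)
    {FF : Filter F} (f : T -> 'M[R]_(m, n)) (A : 'M[R]_(m, n)) i j :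
  f x @[x --> F] --> A -> f x i j @[x --> F] --> A i j.
Proof.
move=> fA; apply: (cvg_comp f (fun M : 'M[R]_(m, n) => M i j) fA).
exact: coord_continuous.
Qed.

Lemma cvg_sum {R : realType} {T I : Type} (F : set_system T) {FF : Filter F}
    (s : seq I) (f : I -> T -> R) (l : I -> R) :
  (forall i, f i x @[x --> F] --> l i) ->
  (fun x => \sum_(i <- s) f i x) @ F --> \sum_(i <- s) l i.
Proof.
move=> fl; elim: s => [|i s IH].
  rewrite big_nil (_ : (fun x => _) = fun=> 0); first exact: cvg_cst.
  by apply/funext => x; rewrite big_nil.
rewrite big_cons (_ : (fun x => _) = fun x => f i x + \sum_(j <- s) f j x).
  exact: cvgD.
by apply/funext => x; rewrite big_cons.
Qed.

Lemma cvg_mulmx {R : realType} {m n p : nat} {T : Type} (F : set_system T)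
    {FF : Filter F} (f : T -> 'M[R]_(m, n)) (g : T -> 'M[R]_(n, p))
    (A : 'M[R]_(m, n)) (B : 'M[R]_(n, p)) :
  f x @[x --> F] --> A -> g x @[x --> F] --> B ->
  f x *m g x @[x --> F] --> A *m B.
Proof.
move=> fA gB; apply: cvg_mx => i j; rewrite mxE.
rewrite [X in X @ _](_ : _ = fun x => \sum_k f x i k * g x k j); last first.
  by apply/funext => x; rewrite mxE.
apply: cvg_sum => k; apply: cvgM.
  exact: cvg_coord.
exact: cvg_coord.
Qed.

Section SOn1_topology.
Context {R : realType} {n : nat}.
Local Notation G := (SOn1 R n).
Local Notation J := (Jmx R n).

Lemma val_SOn1_continuous : continuous (\val : G -> 'M[R]_(n + 1)).
Proof. by apply/continuousP => A oA; exists A. Qed.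

Lemma cvg_SOn1 {T : Type} (F : set_system T) {FF : Filter F} (f : T -> G) (g : G) :
  \val (f x) @[x --> F] --> \val g -> f x @[x --> F] --> g.
Proof.
move=> fg A /=; rewrite nbhsE => -[B [[C oC CB] Bg] BA].
have /fg : nbhs (\val g) C by apply: open_nbhs_nbhs; split => //; rewrite -CB in Bg.
move=> fC; apply: (@filterS _ F _ (fun x => C (\val (f x)))) => // x Cx.
by apply: BA; rewrite -CB.
Qed.

Lemma cvg_mulg {T : Type} (F : set_system T) {FF : Filter F} (f g : T -> G) (a b : G) :
  f x @[x --> F] --> a -> g x @[x --> F] --> b -> (f x * g x)%g @[x --> F] --> (a * b)%g.
Proof.
move=> fa gb; apply: cvg_SOn1; apply: cvg_mulmx.
  exact: (cvg_comp f _ fa (val_SOn1_continuous a)).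
exact: (cvg_comp g _ gb (val_SOn1_continuous b)).
Qed.

Lemma val_invg (g : G) : \val (g^-1)%g = J *m (\val g)^T *m J.
Proof.
have [gJ _] := SOn1P g.
have E : J *m (\val g)^T *m J *m \val g = 1%:M.
  by rewrite -!mulmxA (mulmxA _ J) gJ mulJJ.
by rewrite -[RHS]mulmx1 -(mulmxV (SOn1_unit g)) mulmxA E mul1mx.
Qed.

Lemma cvg_invg {T : Type} (F : set_system T) {FF : Filter F} (f : T -> G) (a : G) :
  f x @[x --> F] --> a -> (f x)^-1%g @[x --> F] --> (a^-1)%g.
Proof.
move=> fa; apply: cvg_SOn1; rewrite val_invg.
under eq_fun do rewrite val_invg.
apply: cvg_mulmx; last exact: cvg_cst.
apply: cvg_mulmx; first exact: cvg_cst.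
apply: cvg_mx => i j; rewrite mxE.
rewrite [X in X @ _](_ : _ = fun x => \val (f x) j i); last first.
  by apply/funext => x; rewrite mxE.
apply: (cvg_coord F (fun x => \val (f x))).
exact: (cvg_comp f _ fa (val_SOn1_continuous a)).
Qed.

(** A matrix preserving the form has determinant 1 or -1, so its square has determinant 1. Elements
    of a one-parameter group are squares, which settles their determinant without computing it. *)
Lemma SOn1_set_sqr (A B : 'M[R]_(n + 1)) :
  A = B *m B -> B^T *m J *m B = J -> SOn1_set A.
Proof.
move=> -> BJ; split.
  have E : B^T *m (B^T *m J *m B) *m B = J by rewrite BJ.
  by rewrite -[RHS]E trmx_mul !mulmxA.
have /(congr1 determinant) := BJ; rewrite !det_mulmx det_tr mulrAC -[RHS]mul1r.
apply: mulIr; have : (1 : R) \is a GRing.unit by exact: unitr1.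
by rewrite -(det1 R (n + 1)) -mulJJ det_mulmx unitrM => /andP[].
Qed.

End SOn1_topology.

(** * The unipotent one-parameter group and its renormalization *)

Section unipotent_flow.
Context {R : realType} {n : nat}.
Local Notation G := (SOn1 R n).
Local Notation J := (Jmx R n).
Variable U : 'M[R]_(n + 1).
Hypotheses (hU : son1 R n U) (U3 : U ^+ 3 = 0).

(** The exponential series of [t *: U], which stops after the quadratic term because
    [U ^+ 3 = 0]. *)
Definition uexp (t : R) : 'M[R]_(n + 1) := 1%:M + t *: U + (t ^+ 2 / 2) *: (U *m U).

Lemma uexpD s t : uexp (s + t) = uexp s *m uexp t.
Proof.
have U3' : U *m U *m U = 0 by rewrite !mulmxE -expr2 -exprSr.
rewrite /uexp !(mulmxDl, mulmxDr, mul1mx, mulmx1) -!(scalemxAl, scalemxAr).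
rewrite !scalerA !mulmxA U3' mul0mx !scaler0 !addr0.
have -> : (s + t) ^+ 2 / 2 = s ^+ 2 / 2 + s * t + t ^+ 2 / 2 :> R by field.
by rewrite !scalerDl; apply/matrixP => i j; rewrite !mxE; ring.
Qed.

Lemma uexp0 : uexp 0 = 1%:M.
Proof. by rewrite /uexp expr0n mul0r !scale0r !addr0. Qed.

Lemma uexp_form t : (uexp t)^T *m J *m uexp t = J.
Proof.
move: hU; rewrite /son1 /= => /eqP; rewrite addr_eq0 => /eqP UJ.
have -> : (uexp t)^T *m J = J *m uexp (- t).
  have -> : (uexp t)^T = 1%:M + t *: U^T + (t ^+ 2 / 2) *: (U^T *m U^T).
    by rewrite /uexp !raddfD /= !linearZ /= trmx1 trmx_mul.
  rewrite /uexp !(mulmxDl, mulmxDr) mul1mx mulmx1 -!(scalemxAl, scalemxAr).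
  rewrite -mulmxA UJ mulmxN mulmxA UJ mulNmx opprK sqrrN scaleNr scalerN.
  by rewrite mulmxA.
by rewrite -mulmxA -uexpD addNr uexp0 mulmx1.
Qed.

Lemma uexp_SOn1 t : uexp t \in SOn1_set (R := R) (n := n).
Proof.
rewrite inE; apply: (@SOn1_set_sqr _ _ _ (uexp (t / 2))); last exact: uexp_form.
by rewrite -uexpD -splitr.
Qed.

Lemma scalemx_exp t k : (t *: U) ^+ k = t ^+ k *: U ^+ k.
Proof.
elim: k => [|k IH]; first by rewrite !expr0 scale1r.
by rewrite !exprS IH -!mulmxE -scalemxAl -scalemxAr scalerA.
Qed.

Lemma expm_uexp t : expm (t *: U) = uexp t.
Proof.
rewrite /expm; apply: (@lim_near_cst _ hausdorff_mx).
near=> k.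
have k3 : (3 <= k)%N by near: k; exists 3.
rewrite /series /= (big_cat_nat _ (n := 3))//= [X in _ + X]big1_seq.
  rewrite addr0 !big_nat_recl// big_geq// addr0 /uexp expr0 fact0 !invr1 !scale1r.
  by rewrite expr1 addrA !scalemx_exp scalerA mulrC.
move=> i /andP[_]; rewrite mem_index_iota => /andP[i3 _].
by rewrite scalemx_exp -(subnK i3) [U ^+ _]exprD U3 mulr0 !scaler0.
Unshelve. all: by end_near. Qed.

Lemma val_gexp t : \val (gexp (t *: U)) = uexp t.
Proof. by rewrite /gexp val_insubd expm_uexp uexp_SOn1. Qed.

Lemma gexpD s t : gexp ((s + t) *: U) = (gexp (s *: U) * gexp (t *: U))%g.
Proof. by apply: val_inj; rewrite /= !val_gexp uexpD. Qed.

Lemma gexp0 : gexp (0 *: U) = 1%g.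
Proof. by apply: val_inj; rewrite /= val_gexp uexp0. Qed.

Lemma uexp_continuous : continuous uexp.
Proof.
move=> t; apply: cvg_mx => i j.
rewrite [X in X @ _](_ : _ = fun s => 1%:M i j + s * U i j + s ^+ 2 / 2 * (U *m U) i j).
  rewrite !mxE; apply: cvgD; first apply: cvgD; first exact: cvg_cst.
    by apply: cvgMl; exact: cvg_id.
  apply: cvgMl; apply: cvgMl; apply: exprn_continuous.
by apply/funext => s; rewrite !mxE.
Qed.

Lemma gexp_continuous : continuous (fun t : R => gexp (t *: U)).
Proof.
move=> t; apply: cvg_SOn1; rewrite val_gexp.
rewrite [X in X @ _](_ : _ = uexp); first exact: uexp_continuous.
by apply/funext => s; rewrite val_gexp.
Qed.

(** The semisimple element [H] of the grading satisfies [[H, U] = U], so conjugation by its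
    one-parameter group rescales [U], as the geodesic flow does for the horocycle flow. Parameters
    tending to 1 will supply the maps [a_k]. *)
Lemma SOn1_renormalization : nilpotent_mx U -> U != 0 ->
  exists dil : R -> G,
    [/\ forall lam, 0 < lam -> forall t,
          (dil lam * gexp (t *: U))%g = (gexp ((lam * t) *: U) * dil lam)%g
      & dil lam @[lam --> (1 : R)] --> (1%g : G)].
Proof.
move=> Unil U0; have [P [Q [[PP QQ PQ QP] PJ UP QU PUQ]]] :=
  son1_nilpotent_grading _ hU Unil U0.
(* [a lam] is [exp (ln lam * H)] for [H = P - Q]. *)
pose a lam : 'M[R]_(n + 1) := 1%:M + (lam - 1) *: P + (lam^-1 - 1) *: Q.
have aM l k : a l *m a k = a (l * k).
  rewrite /a !(mulmxDl, mulmxDr, mul1mx, mulmx1) -!(scalemxAl, scalemxAr).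
  rewrite PP QQ PQ QP !scaler0 !addr0 !scalerA.
  by apply/matrixP => i j; rewrite !mxE invfM; ring.
have QJ : Q^T *m J = J *m P.
  by rewrite -[P]trmxK -[J in RHS]trmx_J -trmx_mul PJ trmx_mul trmx_J.
have aJ l : l != 0 -> (a l)^T *m J *m a l = J.
  move=> l0; have -> : (a l)^T *m J = J *m a (l^-1).
    have -> : (a l)^T = 1%:M + (l - 1) *: P^T + (l^-1 - 1) *: Q^T.
      by rewrite /a !raddfD /= !linearZ /= trmx1.
    rewrite /a invrK !(mulmxDl, mulmxDr) mul1mx mulmx1 -!(scalemxAl, scalemxAr).
    by rewrite PJ QJ addrAC.
  by rewrite -mulmxA aM mulVf// /a invr1 subrr !scale0r !addr0 mulmx1.
have aS l : 0 < l -> a l \in SOn1_set (R := R) (n := n).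
  (* [a l] is the square of [a (Num.sqrt l)]. *)
  move=> l0; rewrite inE; apply: (@SOn1_set_sqr _ _ _ (a (Num.sqrt l))).
    by rewrite aM -expr2 sqr_sqrtr// ltW.
  by apply: aJ; rewrite sqrtr_eq0 -ltNge.
pose dil lam : G := insubd (1%g : G) (a lam).
have dilE l : 0 < l -> \val (dil l) = a l by move=> l0; rewrite val_insubd aS.
exists dil; split.
  move=> l l0 t; apply: val_inj; rewrite /= dilE// !val_gexp.
  have aU : a l *m U = l *: (U *m a l).
    rewrite /a !(mulmxDl, mulmxDr, mul1mx, mulmx1) -!(scalemxAl, scalemxAr) UP QU.
    have -> : U *m Q = U - P *m U by rewrite -[X in X - _]PUQ addrC addKr.
    move: (P *m U) => X; apply/matrixP => i j; rewrite !mxE.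
    by field; rewrite gt_eqF.
  move: (a l) aU => A aU.
  rewrite /uexp !(mulmxDl, mulmxDr, mul1mx, mulmx1) -!(scalemxAl, scalemxAr).
  rewrite mulmxA aU -scalemxAl -(mulmxA U A) aU -scalemxAr mulmxA !scalerA.
  by congr (_ + _ *: _ + _ *: _); [rewrite mulrC|field].
have nz : \forall l \near (1 : R), 0 < l by exact: lt_nbhsr.
apply: (@cvg_SOn1 _ _ _ (nbhs (1 : R)) _ dil 1%g).
apply: (@cvg_trans _ (a l @[l --> (1 : R)])).
  apply: near_eq_cvg; apply: filterS nz => l l0; by rewrite dilE.
have -> : \val (1%g : G) = a 1 by rewrite /a invr1 subrr !scale0r !addr0.
apply: (@cvg_mx _ _ _ _ (nbhs (1 : R)) _ a (a 1)) => i j.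
rewrite [X in X @ _](_ : _ = fun l => 1%:M i j + (l - 1) * P i j + (l^-1 - 1) * Q i j).
  rewrite !mxE; apply: cvgD; first apply: cvgD; first exact: cvg_cst.
    by apply: cvgMl; apply: cvgB; [exact: cvg_id|exact: cvg_cst].
  apply: cvgMl; apply: cvgB; [|exact: cvg_cst].
  by apply: cvgV; [exact: oner_neq0|exact: cvg_id].
by apply/funext => s; rewrite !mxE.
Qed.

End unipotent_flow.

(** * Almost fixed sets and antiperiodicity *)

Section measure_preserving.
Context {d : measure_display} {T : measurableType d} {R : realType}.
Variable mu : probability T R.

Definition measure_preserving (f : T -> T) : Prop :=
  measurable_fun setT f /\ forall A, measurable A -> mu (f @^-1` A) = mu A.

Lemma measurable_preimage (f : T -> T) A :
  measure_preserving f -> measurable A -> measurable (f @^-1` A).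
Proof. by move=> [mf _] mA; rewrite -[_ @^-1` _]setTI; exact: mf. Qed.

Lemma le_measure_ae A B : measurable A -> measurable B ->
  {ae mu, forall x, A x -> B x} -> (mu A <= mu B)%E.
Proof.
move=> mA mB [N [mN N0 AB]].
rewrite -[leRHS]adde0 -N0 (le_trans _ (measureU2 _ mB mN))//.
apply: le_measure; rewrite ?inE//; first exact: measurableU.
move=> x Ax; have [Bx|nBx] := pselect (B x); [by left|right].
by apply: AB => /(_ Ax).
Qed.

Lemma measure_eq_ae A B : measurable A -> measurable B ->
  {ae mu, forall x, A x <-> B x} -> mu A = mu B.
Proof.
move=> mA mB AB; apply/eqP; rewrite eq_le; apply/andP; split; apply: le_measure_ae => //.
  by apply: filterS AB => x [].
by apply: filterS AB => x [].
Qed.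

Lemma ae_preimage (f : T -> T) (P : T -> Prop) : measure_preserving f ->
  {ae mu, forall x, P x} -> {ae mu, forall x, P (f x)}.
Proof.
move=> [mf fmu] [N [mN N0 PN]]; exists (f @^-1` N); split.
- by rewrite -[_ @^-1` _]setTI; exact: mf.
- by rewrite fmu.
- by move=> x; exact: PN.
Qed.

Lemma small_tail (F : nat -> set T) : (forall n, measurable (F n)) ->
  {homo F : m n / (m <= n)%N >-> (n <= m)%O} -> \bigcap_n F n = set0 ->
  forall e : R, 0 < e -> exists n, (mu (F n) < e%:E)%E.
Proof.
move=> mF dF F0 e e0.
have : mu \o F @ \oo --> mu (\bigcap_n F n).
  apply: nonincreasing_cvg_mu => //; last exact: bigcapT_measurable.
  by rewrite (le_lt_trans (probability_le1 _ _)) ?ltry.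
rewrite F0 measure0 => cF.
have [|n _ nP] := cF [set y | (y < e%:E)%E].
  by apply: open_nbhs_nbhs; split; [exact: open_ereal_lt_ereal|rewrite /= lte_fin].
by exists n; exact: (nP n (leqnn n)).
Qed.

Definition asymptotically_fixed (a : nat -> T -> T) (C : set T) : Prop :=
  forall e : R, 0 < e -> \forall k \near \oo, (mu (C `\` a k @^-1` C) < e%:E)%E.

Section asymptotically_fixed.
Variable a : nat -> T -> T.
Hypothesis amp : forall k, measure_preserving (a k).
Let ma k C := @measurable_preimage (a k) C (amp k).

(** Complementation exchanges the two halves of the symmetric difference of [C] and its preimage,
    and these have equal measure because [a k] preserves [mu]. *)
Lemma asymptotically_fixedC C : measurable C ->
  asymptotically_fixed a C -> asymptotically_fixed a (~` C).
Proof.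
move=> mC aC e e0; apply: filterS (aC e e0) => k.
suff -> : mu (~` C `\` a k @^-1` (~` C)) = mu (C `\` a k @^-1` C) by [].
have -> : ~` C `\` a k @^-1` (~` C) = a k @^-1` C `\` C.
  apply/seteqP; split => x [h1 h2]; split => //.
  exact: contrapT.
have fin A : measurable A -> (mu A < +oo)%E.
  by move=> mA; rewrite (le_lt_trans (probability_le1 _ mA)) ?ltry.
have mk := ma k _ mC; rewrite (measureD mk mC (fin _ mk)) (measureD mC mk (fin _ mC)).
by congr (_ - _)%E; [exact: (amp k).2|rewrite setIC].
Qed.

Lemma asymptotically_fixedU A B : measurable A -> measurable B ->
  asymptotically_fixed a A -> asymptotically_fixed a B ->
  asymptotically_fixed a (A `|` B).
Proof.
move=> mA mB aA aB e e0; have e2 : 0 < e / 2 by rewrite divr_gt0.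
near=> k; rewrite (splitr e) EFinD.
apply: (@le_lt_trans _ _ (mu (A `\` a k @^-1` A) + mu (B `\` a k @^-1` B))%E).
  apply: (@le_trans _ _ (mu ((A `\` a k @^-1` A) `|` (B `\` a k @^-1` B)))).
    apply: le_measure; rewrite ?inE.
    - by apply: measurableD; [exact: measurableU|apply: ma; exact: measurableU].
    - by apply: measurableU; apply: measurableD => //; exact: ma.
    - by move=> x [[Ax|Bx] /not_orP[nA nB]]; [left|right].
  by apply: measureU2; apply: measurableD => //; exact: ma.
by apply: lteD; near: k; [exact: aA|exact: aB].
Unshelve. all: by end_near. Qed.

Lemma asymptotically_fixed_approx C : measurable C ->
  (forall e : R, 0 < e -> exists A, [/\ measurable A, A `<=` C,
     asymptotically_fixed a A & (mu (C `\` A) < e%:E)%E]) ->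
  asymptotically_fixed a C.
Proof.
move=> mC approx e e0; have e2 : 0 < e / 2 by rewrite divr_gt0.
have [A [mA AC aA CA]] := approx _ e2.
near=> k; rewrite (splitr e) EFinD.
apply: (@le_lt_trans _ _ (mu (C `\` A) + mu (A `\` a k @^-1` A))%E).
  apply: (@le_trans _ _ (mu ((C `\` A) `|` (A `\` a k @^-1` A)))).
    apply: le_measure; rewrite ?inE.
    - by apply: measurableD => //; exact: ma.
    - by apply: measurableU; apply: measurableD => //; exact: ma.
    - move=> x [Cx nC]; have [Ax|] := pselect (A x); last by left.
      by right; split => // /AC.
  by apply: measureU2; apply: measurableD => //; exact: ma.
by apply: lteD => //; near: k; exact: aA.
Unshelve. all: by end_near. Qed.

(** Finite unions exhaust the countable one up to small measure, by continuity from above of the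
    remainder. *)
Lemma asymptotically_fixed_bigcup (C : nat -> set T) :
  (forall i, measurable (C i)) -> (forall i, asymptotically_fixed a (C i)) ->
  asymptotically_fixed a (\bigcup_i C i).
Proof.
move=> mC aC; have mS n : measurable (\big[setU/set0]_(i < n) C i).
  exact: bigsetU_measurable.
apply: asymptotically_fixed_approx; first exact: bigcupT_measurable.
move=> e e0; have := @small_tail (fun n => \bigcup_i C i `\` \big[setU/set0]_(i < n) C i).
move=> /(_ _ _ _ e e0)[].
- by move=> n; apply: measurableD => //; exact: bigcupT_measurable.
- by move=> m n mn; apply/subsetPset; apply: setDS; exact: subset_bigsetU.
- apply/seteqP; split => // x /= H; have [[i _ Cx] _] := H 0%N I.
  by have [_] := H i.+1 I; apply; rewrite big_ord_recr /=; right.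
move=> n nE; exists (\big[setU/set0]_(i < n) C i); split => //.
  by rewrite -bigcup_mkord; apply: bigcup_sub => i _; exact: bigcup_sup.
elim: n {nE} => [|n IH].
  by rewrite big_ord0 => f f0; apply: nearW => k; rewrite set0D measure0 lte_fin.
rewrite big_ord_recr /=; by apply: asymptotically_fixedU => //; exact: mS.
Qed.

(* Open sets satisfy the hypothesis when [a k] tends to the identity pointwise. *)
Lemma asymptotically_fixed_eventually C : measurable C ->
  (forall x, C x -> \forall k \near \oo, C (a k x)) -> asymptotically_fixed a C.
Proof.
move=> mC Cev e e0.
pose F n := C `\` \bigcap_(k in [set k | (n <= k)%N]) a k @^-1` C.
have mF n : measurable (F n).
  by apply: measurableD => //; apply: bigcap_measurable => [|k _]; [exists n => /=|exact: ma].
have [] := @small_tail F mF _ _ e e0.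
- move=> m n mn; apply/subsetPset; apply: setDS => x /= H k nk; apply: H.
  exact: leq_trans nk.
- apply/seteqP; split => // x /= H; have [Cx _] := H 0%N I.
  have [N _ NP] := Cev x Cx; have [_] := H N I; apply => k /= Nk; exact: NP.
move=> n nE; exists n => // k /= nk; apply: le_lt_trans nE; apply: le_measure.
- by rewrite inE; apply: measurableD => //; exact: ma.
- by rewrite inE.
- by move=> x [Cx nCx]; split => // /(_ k nk).
Qed.

End asymptotically_fixed.

(** The map [a k] conjugates time [(2 k + 2) h] to time [(2 k + 3) h], two multiples of [h] of
    opposite parity with ratio tending to 1. Up to null sets the even one preserves [C] and the odd
    one moves it to its complement in [Z], which is compatible with [C] being almost fixed by [a k]
    only if [C] is null. *)
Lemma no_antiperiodic_set (phi : R -> T -> T) (a : nat -> T -> T) (h : R) (C Z : set T) :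
  (forall t, measure_preserving (phi t)) -> (forall k, measure_preserving (a k)) ->
  (forall x, phi 0 x = x) -> (forall s t x, phi (s + t) x = phi s (phi t x)) ->
  (forall k t x, a k (phi t x) = phi ((k.*2.+3)%:R / (k.*2.+2)%:R * t) (a k x)) ->
  measurable C -> measurable Z -> C `<=` Z -> asymptotically_fixed a C ->
  {ae mu, forall x, [/\ C x -> (Z `\` C) (phi h x), (Z `\` C) x -> C (phi h x)
                      & ~ Z x -> ~ Z (phi h x)]} ->
  mu Z = 0%E.
Proof.
move=> mphi ma phi0 phiD aphi mC mZ CZ aC flip.
pose D := Z `\` C; have mD : measurable D by exact: measurableD.
(* The cases [C], [D] and outside [Z] are exhaustive and are sent to disjoint sets, so the
   implications become equivalences. *)
have swap : {ae mu, forall x, (C x <-> D (phi h x)) /\ (D x <-> C (phi h x))}.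
  apply: filterS flip => x [Cx Dx Zx]; split; split => //.
  - move=> [Zhx nCh]; apply: contrapT => nCx.
    have [Zxx|/Zx//] := pselect (Z x).
    by apply: nCh; apply: Dx.
  - move=> Chx; split; last by move=> /Cx[].
    by apply: contrapT => /Zx; apply; exact: CZ.
have swap_iter m : {ae mu, forall x, C x <-> (if odd m then D else C) (phi (h *+ m) x)}.
  elim: m => [|m IH]; first by apply: aeW => x; rewrite mulr0n phi0.
  have := ae_preimage _ _ (mphi (h *+ m)) swap; apply: filterS2 IH => x -> [CD DC].
  by rewrite mulrS phiD /=; case: (odd m).
have C0 : mu C = 0%E.
  apply/eqP; rewrite eq_le measure_ge0 andbT; apply/lee_addgt0Pr => e e0.
  rewrite add0e; have e2 : 0 < e / 2 by rewrite divr_gt0.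
  have [k _ /(_ k (leqnn _)) ke] := aC _ e2.
  have mCk := measurable_preimage _ _ (ma k) mC.
  have mDk := measurable_preimage _ _ (ma k) mD.
  rewrite (measureDI mu mC mCk) (splitr e) EFinD; apply: leeD; first exact: ltW.
  apply: le_trans (ltW ke).
  (* Both sets are compared through the flow at time [(2 k + 2) h]: [C] returns to itself, whereas
     the preimage of [C] under [a k] goes to the preimage of [D]. *)
  rewrite [leLHS](_ : _ = mu (C `&` a k @^-1` D)); last first.
    rewrite -[RHS](mphi (h *+ k.*2.+2)).2; last exact: measurableI.
    apply: measure_eq_ae; first exact: measurableI.
      by apply: measurable_preimage _ _ (mphi _) _; exact: measurableI.
    have := ae_preimage _ _ (ma k) (swap_iter k.*2.+3).
    apply: filterS2 (swap_iter k.*2.+2) => x.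
    rewrite /= odd_double /= => -> aE; rewrite aE aphi.
    suff -> : (k.*2.+3)%:R / (k.*2.+2)%:R * (h *+ k.*2.+2) = h *+ k.*2.+3 by [].
    by rewrite -[h *+ k.*2.+2]mulr_natl mulrA divfK ?pnatr_eq0// mulr_natl.
  apply: le_measure; rewrite ?inE; [exact: measurableI|exact: measurableD|].
  by move=> x [Cx [_ nCx]]; split.
have D0 : mu D = 0%E.
  rewrite -C0 -[RHS](mphi h).2//; apply: measure_eq_ae => //.
    exact: measurable_preimage _ _ (mphi h) mC.
  by apply: filterS swap => x [_].
have -> : Z = C `|` D by rewrite /D setDUK.
apply/eqP; rewrite eq_le measure_ge0 andbT.
apply: le_trans (measureU2 _ mC mD) _.
by rewrite [X in (X + _)%E]C0 [X in (_ + X)%E]D0 adde0.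
Qed.

End measure_preserving.

(** * Flows under a return-time function *)

(** An element within [delta] of the infimum is the minimum, since a smaller one would be closer to
    it than [delta]. *)
Lemma spaced_set_min {R : realType} (A : set R) (delta : R) : 0 < delta ->
  A !=set0 -> (forall t, A t -> 0 <= t) ->
  (forall s t, A s -> A t -> `|t - s| < delta -> s = t) ->
  exists2 m, A m & forall t, A t -> m <= t.
Proof.
move=> d0 A0 Age0 Asp.
have infA : has_inf A by split => //; exists 0 => t /Age0.
have [a Aa aE] := inf_adherent d0 infA.
exists a => // t At; rewrite leNgt; apply/negP => ta.
have it : inf A <= t by apply: ge_inf => //; exact: infA.2.
have := Asp _ _ At Aa; rewrite gtr0_norm ?subr_gt0// => at_.
have := ta; rewrite at_ ?ltxx//; lra.
Qed.

Lemma measurable_fun_ltP {d} {T : measurableType d} {R : realType} (f : T -> R) :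
  (forall r, measurable [set x | f x < r]) -> measurable_fun setT f.
Proof.
move=> mf; apply: (measurability _ (RGenInftyO.measurableE R)) => _ [_ [r ->] <-].
rewrite setTI (_ : _ @^-1` _ = [set x | f x < r]); first exact: mf.
by apply/seteqP; split => x /=; rewrite in_itv.
Qed.

Lemma measurable_fun_pos_inv {d} {T : measurableType d} {R : realType} (f : T -> R) :
  measurable_fun setT f -> (forall x, 0 < f x) ->
  measurable_fun setT (fun x => (f x)^-1).
Proof.
move=> mf f0; apply: measurable_fun_ltP => r.
have [r0|r0] := ltP 0 r; last first.
  rewrite (_ : [set x | _] = set0)//; apply/seteqP; split => // x /= fr.
  have : 0 < (f x)^-1 by rewrite invr_gt0.
  lra.
rewrite (_ : [set x | _] = f @^-1` `]r^-1, +oo[%classic).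
  by rewrite -[_ @^-1` _]setTI; apply: mf.
apply/seteqP; split => x /=; rewrite in_itv /= andbT => h.
  by rewrite -[r]invrK ltf_pV2 ?posrE ?invr_gt0// in h.
by rewrite -[r]invrK ltf_pV2 ?posrE ?invr_gt0.
Qed.

Lemma integral_gt0 {d} {T : measurableType d} {R : realType}
    (mu : {measure set T -> \bar R}) (D : set T) (f : T -> R) :
  measurable D -> (0 < mu D)%E -> measurable_fun D f -> (forall x, D x -> 0 < f x) ->
  (0 < \int[mu]_(x in D) (f x)%:E)%E.
Proof.
move=> mD muD mf f0; rewrite lt_def; apply/andP; split; last first.
  by apply: integral_ge0 => x Dx; rewrite lee_fin ltW// f0.
apply/negP => /eqP I0.
have : (\int[mu]_(x in D) `|(f x)%:E| = 0)%E.
  rewrite -[RHS]I0; apply: eq_integral => x; rewrite inE => Dx.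
  by rewrite gee0_abs// lee_fin ltW// f0.
move=> /(ae_eq_integral_abs mu mD)[|N [mN N0 DN]].
  exact/measurable_EFinP.
have : (mu D <= mu N)%E.
  apply: le_measure; rewrite ?inE// => x Dx; apply: DN => /= /(_ Dx)[] fx.
  by have := f0 _ Dx; rewrite fx ltxx.
by rewrite N0 leNgt muD.
Qed.

(* [xi U] is [clock (flow U)]. *)
Definition clock {R : realType} {T : Type} (phi : R -> T -> T) (tau : T -> R)
    (x : T) (t : R) : R :=
  if 0 <= t then \int[lebesgue_measure]_(s in `[0, t]) tau (phi s x)
  else - \int[lebesgue_measure]_(s in `[t, 0]) tau (phi s x).

Section special_flow.
Context {d : measure_display} {T : measurableType d} {R : realType}.
Variables (mu : probability T R) (phi : R -> T -> T) (S : set T) (delta : R).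
Hypothesis phi0 : forall x, phi 0 x = x.
Hypothesis phiD : forall s t x, phi (s + t) x = phi s (phi t x).
Hypothesis mphi : forall t, measure_preserving mu (phi t).
Hypothesis morb : forall x, measurable_fun setT (fun t : R => phi t x).
Hypothesis delta0 : 0 < delta.
Hypothesis spaced : forall x t, S x -> S (phi t x) -> `|t| < delta -> t = 0.

Definition hits (a b : R) : set T := [set x | exists t : R, a < t < b /\ S (phi t x)].

Hypothesis mvisit : forall r, measurable (hits 0 r).

Let phiK t x : phi (- t) (phi t x) = x.
Proof. by rewrite -phiD addNr phi0. Qed.

Let mphi_set t A : measurable A -> measurable (phi t @^-1` A).
Proof. exact: (measurable_preimage mu _ _ (mphi t)). Qed.

Lemma measurable_hits a b : measurable (hits a b).
Proof.
rewrite (_ : hits a b = phi a @^-1` hits 0 (b - a)); first exact/mphi_set/mvisit.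
apply/seteqP; split => x /= [t [tab St]].
  by exists (t - a); rewrite -phiD subrK; split => //; lra.
by exists (t + a); rewrite phiD; split => //; lra.
Qed.

Lemma spaced_visits x s t : S (phi s x) -> S (phi t x) -> `|t - s| < delta -> s = t.
Proof.
move=> Ss St ts; have := @spaced (phi s x) (t - s) Ss.
by rewrite -phiD subrK => /(_ St ts)/eqP; rewrite subr_eq0 => /eqP.
Qed.

Definition recurrent : set T := [set x | forall k : nat,
  (exists t : R, k%:R < t /\ S (phi t x)) /\ (exists t : R, t < - k%:R /\ S (phi t x))].
Local Notation Y := recurrent.

Lemma measurable_recurrent : measurable Y.
Proof.
rewrite (_ : Y = \bigcap_k ((\bigcup_m hits k%:R m%:R) `&` (\bigcup_m hits (- m%:R) (- k%:R)))).
  apply: bigcapT_measurable => k.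
  by apply: measurableI; apply: bigcupT_measurable => m; exact: measurable_hits.
apply/seteqP; split => [x Yx k _|x Yx k].
  have [[t [kt St]] [s [ks Ss]]] := Yx k; split.
    exists (Num.truncn `|t|).+1 => //; exists t; split => //; rewrite kt /=.
    by rewrite (le_lt_trans (ler_norm t))// truncnS_gt.
  exists (Num.truncn `|s|).+1 => //; exists s; split => //; rewrite ks andbT.
  by rewrite ltrNl (le_lt_trans (ler_norm _))// normrN truncnS_gt.
have [[m _ [t [/andP[kt _] St]]] [l _ [s [/andP[_ sk] Ss]]]] := Yx k I.
by split; [exists t|exists s].
Qed.

Lemma recurrent_flow t x : Y x -> Y (phi t x).
Proof.
move=> Yx k; have [[s [ks Ss]] _] := Yx (Num.truncn (k%:R + `|t|)).+1.
have [_ [u [ku Su]]] := Yx (Num.truncn (k%:R + `|t|)).+1.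
have := truncnS_gt (k%:R + `|t|); have := ler_norm t; have := ler_norm (- t).
rewrite normrN => h1 h2 h3; split.
  by exists (s - t); rewrite -phiD subrK; split => //; lra.
by exists (u - t); rewrite -phiD subrK; split => //; lra.
Qed.

Lemma recurrent_flowE t x : Y (phi t x) <-> Y x.
Proof.
split; last exact: recurrent_flow.
by move=> /(recurrent_flow (- t)); rewrite phiK.
Qed.

(** The set and its preimage have the same finite measure, so the inclusion is an equality up to a
    null set. *)
Lemma ae_absorb t A : measurable A -> A `<=` phi t @^-1` A ->
  {ae mu, forall x, A (phi t x) -> A x}.
Proof.
move=> mA At; exists (phi t @^-1` A `\` A); split.
- by apply: measurableD => //; exact: mphi_set.
- have fin : (mu (phi t @^-1` A) < +oo)%E.
    by rewrite (le_lt_trans (probability_le1 _ _)) ?ltry//; exact: mphi_set.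
  rewrite (measureD (mphi_set _ _ mA) mA fin) setIC (setIidl At).
  by rewrite [X in (X - _)%E](mphi t).2// subee// fin_num_measure.
- by move=> x /= /not_implyP[].
Qed.

(* Poincare recurrence: the sets of points visiting [S] after time [k] are
   nested and have equal measures. *)
Lemma recurrent_gt0 r : (0 < mu (hits 0 r))%E -> (0 < mu Y)%E.
Proof.
move=> r0; apply: lt_le_trans r0 _.
pose V := [set x | exists t : R, S (phi t x)].
pose E := [set x | exists t : R, 0 < t /\ S (phi t x)].
pose F := [set x | exists t : R, t < 0 /\ S (phi t x)].
have mE : measurable E.
  rewrite (_ : E = \bigcup_m hits 0 m%:R).
    by apply: bigcupT_measurable => m; exact: measurable_hits.
  apply/seteqP; split => [x [t [t0 St]]|x [m _ [t [/andP[t0 _] St]]]]; last by exists t.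
  exists (Num.truncn `|t|).+1 => //; exists t; split => //; rewrite t0 /=.
  by rewrite (le_lt_trans (ler_norm t))// truncnS_gt.
have mF : measurable F.
  rewrite (_ : F = \bigcup_m hits (- m%:R) 0).
    by apply: bigcupT_measurable => m; exact: measurable_hits.
  apply/seteqP; split => [x [t [t0 St]]|x [m _ [t [/andP[_ t0] St]]]]; last by exists t.
  exists (Num.truncn `|t|).+1 => //; exists t; split => //; rewrite t0 andbT.
  by rewrite ltrNl (le_lt_trans (ler_norm _))// normrN truncnS_gt.
(* A visit at time [t] becomes a future visit after flowing back by an integer above [|t|];
   [ae_absorb], used for all integers at once, transfers membership in [E] to [x] itself. *)
have VE : {ae mu, forall x, V x -> E x}.
  have /ae_foralln H : forall k : nat, {ae mu, forall x, E (phi (- k%:R) x) -> E x}.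
    move=> k; apply: ae_absorb => // x [t [t0 St]] /=; exists (t + k%:R).
    by rewrite -phiD addrK; split => //; have := ler0n R k; lra.
  apply: filterS H => x EE [t St]; apply: (EE (Num.truncn `|t|).+1).
  exists (t + (Num.truncn `|t|).+1%:R); rewrite -phiD addrK; split => //.
  by have := truncnS_gt `|t|; have := ler_norm (- t); rewrite normrN; lra.
have VF : {ae mu, forall x, V x -> F x}.
  have /ae_foralln H : forall k : nat, {ae mu, forall x, F (phi k%:R x) -> F x}.
    move=> k; apply: ae_absorb => // x [t [t0 St]] /=; exists (t - k%:R).
    by rewrite -phiD subrK; split => //; have := ler0n R k; lra.
  apply: filterS H => x EE [t St]; apply: (EE (Num.truncn `|t|).+1).
  exists (t - (Num.truncn `|t|).+1%:R); rewrite -phiD subrK; split => //.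
  by have := truncnS_gt `|t|; have := ler_norm t; lra.
have Vphi t x : V (phi t x) <-> V x.
  split => -[s Ss]; first by exists (s + t); rewrite phiD.
  by exists (s - t); rewrite -phiD subrK.
(* Applying [VE] and [VF] at all integer times along the orbit gives visits arbitrarily far in the
   future and in the past. *)
have VY : {ae mu, forall x, V x -> Y x}.
  have /ae_foralln H1 : forall k : nat, {ae mu, forall x, V x -> E (phi k%:R x)}.
    move=> k; apply: filterS (ae_preimage _ _ _ (mphi k%:R) VE) => x + Vx.
    by apply; exact/Vphi.
  have /ae_foralln H2 : forall k : nat, {ae mu, forall x, V x -> F (phi (- k%:R) x)}.
    move=> k; apply: filterS (ae_preimage _ _ _ (mphi (- k%:R)) VF) => x + Vx.
    by apply; exact/Vphi.
  apply: filterS2 H1 H2 => x H1 H2 Vx k; split.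
    have [t [t0 St]] := H1 k Vx; exists (t + k%:R); rewrite phiD; split => //; lra.
  have [t [t0 St]] := H2 k Vx; exists (t - k%:R); rewrite phiD; split => //; lra.
apply: le_measure_ae; [exact: measurable_hits|exact: measurable_recurrent|].
by apply: filterS VY => x VY [t [_ St]]; apply: VY; exists t.
Qed.

(** The next visit is strictly in the future, while the last one may be at time 0: excursions are
    half open, and a point of [S] belongs to the excursion that it starts. *)
Definition is_next_visit (x : T) (n : R) : Prop :=
  [/\ 0 < n, S (phi n x) & forall t, 0 < t < n -> ~ S (phi t x)].
Definition is_last_visit (x : T) (p : R) : Prop :=
  [/\ 0 <= p, S (phi (- p) x) & forall t, 0 <= t < p -> ~ S (phi (- t) x)].
(* Off [Y] the junk values [1] and [0] make [rate] equal to [1]. *)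
Definition next_visit (x : T) : R := xget 1 [set n | Y x /\ is_next_visit x n].
Definition last_visit (x : T) : R := xget 0 [set p | Y x /\ is_last_visit x p].

Lemma is_next_visit_uniq x n m : is_next_visit x n -> is_next_visit x m -> n = m.
Proof.
move=> [n0 Sn ltn] [m0 Sm ltm]; apply/eqP; rewrite eq_le !leNgt; apply/andP; split.
  by apply/negP => mn; apply: (ltn m) => //; rewrite m0.
by apply/negP => mn; apply: (ltm n) => //; rewrite n0.
Qed.

Lemma is_last_visit_uniq x n m : is_last_visit x n -> is_last_visit x m -> n = m.
Proof.
move=> [n0 Sn ltn] [m0 Sm ltm]; apply/eqP; rewrite eq_le !leNgt; apply/andP; split.
  by apply/negP => mn; apply: (ltn m) => //; rewrite m0.
by apply/negP => mn; apply: (ltm n) => //; rewrite n0.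
Qed.

Lemma next_visitP x : Y x -> is_next_visit x (next_visit x).
Proof.
move=> Yx; suff [n nP] : exists n, is_next_visit x n.
  by rewrite /next_visit; case: xgetP => [y _ [_ ]//|/(_ n)]; case.
have [] := @spaced_set_min R [set t | 0 < t /\ S (phi t x)] delta delta0.
- by have [[t [t0 St]] _] := Yx 0%N; exists t.
- by move=> t [/ltW].
- by move=> s t [_ Ss] [_ St]; exact: (spaced_visits x).
- move=> m [m0 Sm] mmin; exists m; split => // t /andP[t0 tm] St.
  by have := mmin t (conj t0 St); rewrite leNgt tm.
Qed.

Lemma last_visitP x : Y x -> is_last_visit x (last_visit x).
Proof.
move=> Yx; suff [n nP] : exists n, is_last_visit x n.
  by rewrite /last_visit; case: xgetP => [y _ [_ ]//|/(_ n)]; case.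
have [] := @spaced_set_min R [set t | 0 <= t /\ S (phi (- t) x)] delta delta0.
- have [_ [t [t0 St]]] := Yx 0%N; exists (- t); rewrite /= opprK; split => //.
  by rewrite oppr0 in t0; lra.
- by move=> t [].
- move=> s t [_ Ss] [_ St] st; apply: oppr_inj; apply: (spaced_visits x) => //.
  by rewrite -opprD normrN.
- move=> m [m0 Sm] mmin; exists m; split => // t /andP[t0 tm] St.
  by have := mmin t (conj t0 St); rewrite leNgt tm.
Qed.

Lemma next_eq x n : Y x -> is_next_visit x n -> next_visit x = n.
Proof. by move=> Yx; apply: is_next_visit_uniq; exact: next_visitP. Qed.

Lemma prev_eq x n : Y x -> is_last_visit x n -> last_visit x = n.
Proof. by move=> Yx; apply: is_last_visit_uniq; exact: last_visitP. Qed.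

Lemma next_notY x : ~ Y x -> next_visit x = 1.
Proof. by move=> nY; rewrite /next_visit; case: xgetP => // y _ []. Qed.

Lemma prev_notY x : ~ Y x -> last_visit x = 0.
Proof. by move=> nY; rewrite /last_visit; case: xgetP => // y _ []. Qed.

Lemma next_gt0 x : 0 < next_visit x.
Proof.
have [Yx|nY] := pselect (Y x); last by rewrite next_notY.
by have [] := next_visitP x Yx.
Qed.

Lemma prev_ge0 x : 0 <= last_visit x.
Proof.
have [Yx|nY] := pselect (Y x); last by rewrite prev_notY.
by have [] := last_visitP x Yx.
Qed.

(** The two visits bounding an excursion happen at distinct times, so [spaced] keeps them [delta]
    apart. *)
Lemma return_ge x : Y x -> delta <= last_visit x + next_visit x.
Proof.
move=> Yx; have [n0 Sn _] := next_visitP x Yx; have [p0 Sp _] := last_visitP x Yx.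
rewrite leNgt; apply/negP => lt_d.
have := spaced_visits x _ _ Sp Sn; rewrite opprK addrC.
rewrite ger0_norm ?addr_ge0// 1?ltW// => /(_ lt_d); lra.
Qed.

Lemma next_flow x s : Y x -> 0 <= s < next_visit x -> next_visit (phi s x) = next_visit x - s.
Proof.
move=> Yx /andP[s0 sn]; have [n0 Sn nmin] := next_visitP x Yx.
apply: next_eq; first exact: recurrent_flow.
split; [lra|by rewrite -phiD subrK|].
by move=> t ht; rewrite -phiD; apply: nmin; lra.
Qed.

Lemma prev_flow x s : Y x -> 0 <= s < next_visit x -> last_visit (phi s x) = last_visit x + s.
Proof.
move=> Yx /andP[s0 sn]; have [n0 Sn nmin] := next_visitP x Yx.
have [p0 Sp pmin] := last_visitP x Yx.
apply: prev_eq; first exact: recurrent_flow.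
split; [lra|by rewrite -phiD opprD subrK|].
move=> t ht; rewrite -phiD; have [ts|st] := ltP t s.
  by apply: nmin; lra.
rewrite (_ : - t + s = - (t - s)); last by lra.
by apply: pmin; lra.
Qed.

Lemma last_visit_next x : Y x -> last_visit (phi (next_visit x) x) = 0.
Proof.
move=> Yx; have [n0 Sn _] := next_visitP x Yx.
apply: prev_eq; first exact: recurrent_flow.
by split; [lra|rewrite oppr0 phi0|move=> t; lra].
Qed.

Lemma measurable_next : measurable_fun setT next_visit.
Proof.
apply: measurable_fun_ltP => r.
rewrite (_ : [set x | _] = (Y `&` hits 0 r) `|` (~` Y `&` [set x | 1 < r])).
  apply: measurableU; apply: measurableI.
  - exact: measurable_recurrent.
  - exact: mvisit.
  - by apply: measurableC; exact: measurable_recurrent.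
  - have [r1|r1] := ltP 1 r; first by rewrite (_ : [set x | _] = setT)//; apply/seteqP.
    rewrite (_ : [set x | _] = set0)//; apply/seteqP; split => // x /=; lra.
apply/seteqP; split => x /=.
  have [Yx|nY] := pselect (Y x); last by rewrite next_notY// => r1; right.
  move=> nr; left; split => //; have [n0 Sn _] := next_visitP x Yx.
  by exists (next_visit x); rewrite n0.
move=> [[Yx [t [/andP[t0 tr] St]]]|[nY r1]]; last by rewrite next_notY.
have [n0 Sn nmin] := next_visitP x Yx.
rewrite ltNge; apply/negP => rn; apply: nmin St; lra.
Qed.

(** For [r > 0] and [x] in [Y], the last visit is less than [r] ago exactly when the point
    [phi (- r) x] has its next visit within time [r]; measurability is thus inherited from
    [next_visit]. *)
Lemma measurable_prev : measurable_fun setT last_visit.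
Proof.
apply: measurable_fun_ltP => r; have [r0|r0] := leP r 0.
  rewrite (_ : [set x | _] = set0)//; apply/seteqP; split => // x /=.
  by have := prev_ge0 x; lra.
rewrite (_ : [set x | _] = (Y `&` phi (- r) @^-1` [set x | next_visit x <= r]) `|` ~` Y).
  apply: measurableU; last by apply: measurableC; exact: measurable_recurrent.
  apply: measurableI; first exact: measurable_recurrent.
  apply: mphi_set; rewrite (_ : [set x | _] = next_visit @^-1` `]-oo, r]%classic).
    by rewrite -[_ @^-1` _]setTI; apply: measurable_next.
  by apply/seteqP; split => x /=; rewrite in_itv.
apply/seteqP; split => x /=.
  have [Yx|nY] := pselect (Y x); last by right.
  move=> pr; left; split => //; have [p0 Sp _] := last_visitP x Yx.
  have [n0 Sn nmin] := next_visitP _ (recurrent_flow (- r) _ Yx).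
  rewrite leNgt; apply/negP => rn; apply: (nmin (r - last_visit x)); first lra.
  by rewrite -phiD addrAC subrr add0r.
move=> [[Yx nr]|nY]; last by rewrite prev_notY.
have [p0 Sp pmin] := last_visitP x Yx.
have [n0 Sn nmin] := next_visitP _ (recurrent_flow (- r) _ Yx).
rewrite ltNge; apply/negP => rp.
apply: (pmin (r - next_visit (phi (- r) x))); first lra.
by rewrite opprB phiD.
Qed.

(** * The density of the time change and its clock *)

Definition rate (x : T) : R := (last_visit x + next_visit x)^-1.

Lemma rate_gt0 x : 0 < rate x.
Proof. by rewrite invr_gt0 ltr_wpDl ?prev_ge0 ?next_gt0. Qed.

Lemma measurable_rate : measurable_fun setT rate.
Proof.
apply: measurable_fun_pos_inv => [|x]; last by rewrite ltr_wpDl ?prev_ge0 ?next_gt0.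
by apply: measurable_funD; [exact: measurable_prev|exact: measurable_next].
Qed.

(** Excursions last at least [delta], and off [Y] the rate is 1. This bound makes [tau] integrable
    over the space and over bounded stretches of every orbit. *)
Lemma rate_le x : rate x <= Num.max 1 delta^-1.
Proof.
rewrite le_max; have [Yx|nY] := pselect (Y x).
  by rewrite lef_pV2 ?posrE ?return_ge ?orbT// ltr_wpDl ?prev_ge0 ?next_gt0.
by rewrite /rate prev_notY// next_notY// add0r invr1 lexx.
Qed.

Lemma rate_flow x s : Y x -> 0 <= s < next_visit x -> rate (phi s x) = rate x.
Proof.
by move=> Yx sn; rewrite /rate next_flow// prev_flow//; congr (_^-1); lra.
Qed.

Lemma bounded_rate {I : Type} (g : I -> T) (A : set I) c :
  [bounded (rate (g s) * c : R^o) | s in A].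
Proof.
exists (Num.max 1 delta^-1 * `|c|); split; first exact: num_real.
move=> M cM s _ /=; apply: le_trans (ltW cM).
rewrite normrM ler_wpM2r// gtr0_norm ?rate_gt0//; exact: rate_le.
Qed.

Definition mean_rate : R := fine (\int[mu]_x (rate x)%:E).

Lemma integrable_rate c : mu.-integrable setT (EFin \o (fun x => rate x * c)).
Proof.
apply: measurable_bounded_integrable => //.
- by rewrite [X in (X < _)%E](probability_setT mu) ltry.
- by apply: measurable_funM; [exact: measurable_rate|exact: measurable_cst].
- exact: (bounded_rate id).
Qed.

Lemma integral_rateE : (\int[mu]_x (rate x)%:E = mean_rate%:E)%E.
Proof.
rewrite /mean_rate fineK//; apply: integrable_fin_num => //.
by have := integrable_rate 1; congr (integrable _ _ _); apply/funext => x /=; rewrite mulr1.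
Qed.

Lemma mean_rate_gt0 : 0 < mean_rate.
Proof.
rewrite -lte_fin -integral_rateE; apply: integral_gt0 => //.
- by rewrite [X in (_ < X)%E](probability_setT mu).
- exact: measurable_rate.
- by move=> x _; exact: rate_gt0.
Qed.

Definition tau (x : T) : R := rate x * mean_rate^-1.

Lemma tau_gt0 x : 0 < tau x.
Proof. by rewrite mulr_gt0 ?rate_gt0 ?invr_gt0 ?mean_rate_gt0. Qed.

Lemma integral_tau : (\int[mu]_x (tau x)%:E = 1)%E.
Proof.
rewrite /tau; under eq_integral do rewrite mulrC EFinM.
rewrite ge0_integralZl_EFin//.
- by rewrite integral_rateE -EFinM mulVf// gt_eqF// mean_rate_gt0.
- by move=> x _; rewrite lee_fin ltW// rate_gt0.
- by apply/measurable_EFinP; exact: measurable_rate.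
- by rewrite invr_ge0 ltW// mean_rate_gt0.
Qed.

Lemma measurable_tau_orbit x : measurable_fun setT (fun s : R => tau (phi s x)).
Proof.
apply: measurable_funM; last exact: measurable_cst.
exact: (measurableT_comp measurable_rate (morb x)).
Qed.

Lemma integrable_tau_orbit x (a b : itv_bound R) : (lebesgue_measure [set` Interval a b] < +oo)%E ->
  lebesgue_measure.-integrable [set` Interval a b] (EFin \o (fun s : R => tau (phi s x))).
Proof.
move=> fin; apply: measurable_bounded_integrable => //.
- by apply: measurable_funTS; exact: measurable_tau_orbit.
- exact: (bounded_rate (fun s => phi s x)).
Qed.

Lemma Rintegral_tau_cst x (A : set R) c : measurable A ->
  (forall s, A s -> rate (phi s x) = c) ->
  \int[lebesgue_measure]_(s in A) tau (phi s x) = c / mean_rate * fine (lebesgue_measure A).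
Proof.
move=> mA Ac; rewrite -Rintegral_cst//; apply: eq_Rintegral => s; rewrite inE => As.
by rewrite /tau Ac.
Qed.

Lemma fin_itvcc (a b : R) : (lebesgue_measure `[a, b]%classic < +oo)%E.
Proof. by rewrite lebesgue_measure_itv; case: ifP => _; rewrite ?ltry// -EFinB ltry. Qed.

Lemma clock_split x a b : 0 <= a -> a <= b -> clock phi tau x b =
  clock phi tau x a + \int[lebesgue_measure]_(s in `]a, b]) tau (phi s x).
Proof.
move=> a0 ab; rewrite /clock a0 (le_trans a0 ab).
rewrite -(@Rintegral_itvB _ _ (BLeft 0) (BRight b) a) ?bnd_simp//; first by rewrite addrC subrK.
by apply: integrable_tau_orbit; exact: fin_itvcc.
Qed.

Lemma clock_lt x a b : 0 <= a -> a < b -> clock phi tau x a < clock phi tau x b.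
Proof.
move=> a0 ab; rewrite (clock_split x a b)// ?ltW// ltrDl.
have fin : (lebesgue_measure `]a, b]%classic < +oo)%E.
  by rewrite lebesgue_measure_itv; case: ifP => _; rewrite ?ltry// -EFinB ltry.
have pos : (0 < lebesgue_measure `]a, b]%classic)%E.
  by rewrite lebesgue_measure_itv /= lte_fin ab -EFinB lte_fin subr_gt0.
apply: fine_gt0; apply/andP; split.
  apply: integral_gt0 => //.
  - by apply: measurable_funTS; exact: measurable_tau_orbit.
  - by move=> s _; exact: tau_gt0.
have := integrable_fin_num _ (integrable_tau_orbit x _ _ fin).
by rewrite fin_numElt => /(_ _)/andP[].
Qed.

Lemma clock_neg x t : t < 0 -> clock phi tau x t <= 0.
Proof.
move=> t0; rewrite /clock [0 <= t]leNgt t0 /= oppr_le0; apply: Rintegral_ge0 => s _.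
by rewrite ltW// tau_gt0.
Qed.

Lemma clock_before_next x t : Y x -> 0 <= t < next_visit x ->
  clock phi tau x t = rate x / mean_rate * t.
Proof.
move=> Yx /andP[t0 tn]; rewrite /clock t0 (@Rintegral_tau_cst x _ (rate x))//.
  rewrite lebesgue_measure_itv /= lte_fin; case: ltP => [_|t0']; first by rewrite -EFinB subr0.
  by rewrite (le_anti (x := t) (y := 0)) ?t0 ?t0'//= mulr0.
move=> s /=; rewrite in_itv /= => /andP[s0 st]; apply: rate_flow => //; lra.
Qed.

Lemma clock_next x : Y x -> clock phi tau x (next_visit x) = rate x / mean_rate * next_visit x.
Proof.
move=> Yx; have n0 := next_gt0 x; rewrite /clock ltW//.
(* The endpoint is dropped because [rate] takes there the value of the following excursion. *)
rewrite -Rintegral_itv_bndo_bndc.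
  rewrite (@Rintegral_tau_cst x _ (rate x))//.
    by rewrite lebesgue_measure_itv /= lte_fin n0 -EFinB subr0.
  by move=> s /=; rewrite in_itv /= => sn; exact: rate_flow.
apply: integrable_tau_orbit.
by rewrite lebesgue_measure_itv; case: ifP => _; rewrite ?ltry// -EFinB ltry.
Qed.

Lemma clock_after_next x t : Y x ->
  next_visit x <= t < next_visit x + next_visit (phi (next_visit x) x) ->
  clock phi tau x t = rate x / mean_rate * next_visit x
    + rate (phi (next_visit x) x) / mean_rate * (t - next_visit x).
Proof.
move=> Yx /andP[nt tm]; have n0 := next_gt0 x.
rewrite (clock_split x (next_visit x) t)// ?ltW// clock_next//; congr (_ + _).
rewrite (@Rintegral_tau_cst x _ (rate (phi (next_visit x) x)))//.
  rewrite lebesgue_measure_itv /= lte_fin; case: ltP => [_|t0]; first by rewrite -EFinB.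
  by rewrite (le_anti (x := t) (y := next_visit x)) ?t0 ?nt//= subrr mulr0.
move=> s /=; rewrite in_itv /= => /andP[ns st].
rewrite -[s](subrK (next_visit x)) phiD rate_flow//; first exact: recurrent_flow.
lra.
Qed.

(** The clock increases strictly on nonnegative times and is nonpositive on negative ones, so a
    positive value is reached at most once and [xget] has to select [t]. *)
Lemma clock_inv x t h : 0 < h -> 0 <= t -> clock phi tau x t = h ->
  xget 0 [set s | clock phi tau x s = h] = t.
Proof.
move=> h0 t0 th; case: xgetP => [s _ /= sh|/(_ t)]; last by [].
have s0 : 0 <= s by rewrite leNgt; apply/negP => /(clock_neg x); rewrite sh; lra.
have [st|ts|//] := ltgtP s t.
  by have := clock_lt x s t s0 st; rewrite sh th ltxx.
by have := clock_lt x t s t0 ts; rewrite sh th ltxx.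
Qed.

Definition first_half : set T := [set x | Y x /\ last_visit x < next_visit x].

Lemma measurable_first_half : measurable first_half.
Proof.
rewrite (_ : first_half = Y `&` ((fun x => last_visit x < next_visit x) @^-1` [set true])).
  apply: measurableI; first exact: measurable_recurrent.
  rewrite -[X in measurable X]setTI; apply: measurable_fun_ltr => //.
  - exact: measurable_prev.
  - exact: measurable_next.
by apply/seteqP; split => x /=.
Qed.

(* In [tau]-time every return to [S] takes time [mean_rate^-1]. *)
Lemma first_half_swap x : Y x ->
  let t := xget 0 [set s | clock phi tau x s = (2 * mean_rate)^-1] in
  first_half x <-> ~ first_half (phi t x).
Proof.
move=> Yx /=; have k0 := mean_rate_gt0; set h := (2 * _)^-1.
have h0 : 0 < h by rewrite invr_gt0 mulr_gt0.
have p0 := prev_ge0 x; have n0 := next_gt0 x.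
have L0 : last_visit x + next_visit x != 0 by rewrite gt_eqF// ltr_wpDl.
have [pn|np] := ltP (last_visit x) (next_visit x).
  (* From the first half, flowing by half the length of the excursion stays inside it. *)
  have tn : 0 <= (last_visit x + next_visit x) / 2 < next_visit x by lra.
  rewrite (clock_inv x ((last_visit x + next_visit x) / 2))//; first last.
  - rewrite clock_before_next// /rate /h; field.
    by rewrite L0 gt_eqF.
  - by case/andP: tn.
  split => // _ [_]; rewrite prev_flow// next_flow//; lra.
set y := phi (next_visit x) x; have Yy : Y y by exact: recurrent_flow.
have m0 := next_gt0 y; have y0 : last_visit y = 0 by exact: last_visit_next.
(* The rest of the current excursion is the fraction [next_visit x / (last_visit x + next_visit x)]
   of it. The deficit [r] from one half is the fraction of the next excursion still to be traversed,
   and [r < 2^-1] puts the endpoint in its first half. *)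
pose r := (last_visit x - next_visit x) / 2 / (last_visit x + next_visit x).
have r0 : 0 <= r by rewrite !divr_ge0//; lra.
have r1 : r < 2^-1 by rewrite ltr_pdivrMr; lra.
have rm : r * next_visit y < next_visit y / 2 by rewrite mulrC ltr_pM2l.
have rm0 : 0 <= r * next_visit y by rewrite mulr_ge0// ltW.
rewrite (clock_inv x (next_visit x + r * next_visit y))//; first last.
- rewrite clock_after_next//; last by rewrite -/y; lra.
  rewrite -/y /rate y0 /h /r; field.
  by rewrite L0 !gt_eqF.
- by lra.
split => [[_]|nB]; first lra.
exfalso; apply: nB; split; first exact: recurrent_flow.
rewrite addrC phiD -/y; move: y Yy m0 y0 rm rm0 => y Yy m0 y0 rm rm0.
rewrite prev_flow// ?next_flow//; lra.
Qed.

Theorem exists_antiperiodic_time_change r : (0 < mu (hits 0 r))%E ->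
  exists (tau : T -> R) (h : R) (B Y : set T),
    [/\ [/\ forall x, 0 < tau x, measurable_fun setT tau,
            mu.-integrable setT (EFin \o tau) & (\int[mu]_x (tau x)%:E = 1)%E],
        [/\ measurable B, measurable Y, B `<=` Y & (0 < mu Y)%E],
        forall t x, Y (phi t x) <-> Y x
      & forall x, Y x -> let t := xget 0 [set s | clock phi tau x s = h] in
          B x <-> ~ B (phi t x)].
Proof.
move=> r0; exists tau, (2 * mean_rate)^-1, first_half, Y; split.
- split; [exact: tau_gt0| |exact: integrable_rate|exact: integral_tau].
  by apply: measurable_funM; [exact: measurable_rate|exact: measurable_cst].
- split; [exact: measurable_first_half|exact: measurable_recurrent|by move=> x []|].
  exact: recurrent_gt0 r0.
- by move=> t x; exact: recurrent_flowE.
- exact: first_half_swap.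
Qed.

End special_flow.

(** * The action of SO(n,1) on the homogeneous space *)

Section homogeneous_space.
Context {R : realType} {n : nat} {Gam : set (SOn1 R n)}.
Local Notation G := (SOn1 R n).
Local Notation X := (homog Gam).

Definition coset_proj (g : G) : X := (\pi_(homog Gam) g)%qT.

Lemma coset_proj_repr (x : X) : coset_proj (repr x) = x.
Proof. exact: reprK. Qed.

Lemma coset_proj_eqP (g h : G) : coset_proj g = coset_proj h <->
  [set (g * c)%g | c in Gam] = [set (h * c)%g | c in Gam].
Proof. by split => [/eqquotP/asboolP//|gh]; apply/eqquotP/asboolP. Qed.

(** The representative chosen in [gact] is immaterial because left translation carries equal cosets
    to equal cosets. *)
Lemma gact_coset_proj (g h : G) : gact g (coset_proj h) = coset_proj (g * h)%g.
Proof.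
rewrite /gact; apply/coset_proj_eqP.
have /coset_proj_eqP E := coset_proj_repr (coset_proj h).
have trans (a : G) : [set (g * a * c)%g | c in Gam] =
    (fun b => (g * b)%g) @` [set (a * c)%g | c in Gam].
  apply/seteqP; split => _ [c cG <-]; first by exists (a * c)%g; [exists c|rewrite mulgA].
  by move: cG => [b bG <-]; exists b => //; rewrite mulgA.
by rewrite !trans E.
Qed.

Lemma gact1 (x : X) : gact 1%g x = x.
Proof. by rewrite -(coset_proj_repr x) gact_coset_proj mul1g. Qed.

Lemma gactM (g h : G) (x : X) : gact (g * h)%g x = gact g (gact h x).
Proof. by rewrite -(coset_proj_repr x) !gact_coset_proj mulgA. Qed.

Lemma open_homogE (A : set X) : open A <-> open (coset_proj @^-1` A).
Proof. by []. Qed.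

Lemma open_measurable_homog (A : set X) : open A -> measurable A.
Proof. by move=> oA; apply: sub_sigma_algebra. Qed.

Lemma open_cvg_preimage {T : topologicalType} {Z : topologicalType} (f : T -> Z) (A : set Z) :
  (forall x, f y @[y --> x] --> f x) -> open A -> open (f @^-1` A).
Proof. by move=> /continuousP; apply. Qed.

Lemma open_gact (g : G) (A : set X) : open A -> open (gact g @^-1` A).
Proof.
move=> /open_homogE oA; apply/open_homogE.
rewrite (_ : _ @^-1` _ = (fun h : G => (g * h)%g) @^-1` (coset_proj @^-1` A)).
  apply: open_cvg_preimage oA => h.
  by apply: (@cvg_mulg _ _ _ (nbhs h) _ (fun=> g) id g h); [exact: cvg_cst|exact: cvg_id].
by apply/seteqP; split => h /=; rewrite gact_coset_proj.
Qed.

Lemma measurable_gact (g : G) : measurable_fun setT (gact g : X -> X).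
Proof.
apply: (measurability (@open X)) => // _ [A oA <-].
by rewrite setTI; apply: open_measurable_homog; exact: open_gact.
Qed.

Lemma cvg_gact {T : Type} (F : set_system T) {FF : Filter F} (f : T -> G) (g : G) (x : X) :
  f t @[t --> F] --> g -> gact (f t) x @[t --> F] --> gact g x.
Proof.
move=> fg A; rewrite nbhsE => -[B [oB Bg] BA].
have : (f t * repr x)%g @[t --> F] --> (g * repr x)%g by apply: cvg_mulg fg _; exact: cvg_cst.
move=> /(_ (coset_proj @^-1` B)) H; apply: (@filterS _ F _ (fun t => B (gact (f t) x))).
  by move=> t; exact: BA.
apply: H; apply: open_nbhs_nbhs; split => //.
Qed.

Section group.
Hypothesis gGam : group_closed (mem Gam).

Lemma Gam1 : Gam 1%g.
Proof. by have [] := gGam; rewrite inE. Qed.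

Lemma GamV_mul (a b : G) : Gam a -> Gam b -> Gam (a * b^-1)%g.
Proof.
move=> aG bG; have [_ /(_ a b)] := gGam.
by rewrite !inE => /(_ aG bG).
Qed.

Lemma GamV (a : G) : Gam a -> Gam (a^-1)%g.
Proof. by move=> aG; have := GamV_mul _ _ Gam1 aG; rewrite mul1g. Qed.

Lemma GamM (a b : G) : Gam a -> Gam b -> Gam (a * b)%g.
Proof. by move=> aG /GamV bG; have := GamV_mul _ _ aG bG; rewrite invgK. Qed.

Lemma coset_proj_eq (a b : G) : coset_proj a = coset_proj b <-> Gam (a^-1 * b)%g.
Proof.
split => [/coset_proj_eqP E|abG].
  have : [set (b * c)%g | c in Gam] b by exists 1%g; [exact: Gam1|rewrite mulg1].
  by rewrite -E => -[c cG <-]; rewrite mulKg.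
apply/coset_proj_eqP/seteqP; split => _ [c cG <-].
  exists ((a^-1 * b)^-1 * c)%g; first by apply: GamM => //; exact: GamV.
  by rewrite invgM invgK !mulgA mulgV mul1g.
by exists (a^-1 * b * c)%g; [exact: GamM|rewrite !mulgA mulgV mul1g].
Qed.

(** The preimage of the image is the union of the right translates of [A] by [Gam]. *)
Lemma open_coset_proj_image (A : set G) : open A -> open (coset_proj @` A).
Proof.
move=> oA; apply/open_homogE.
rewrite (_ : _ @^-1` _ = \bigcup_(c in Gam) ((fun h : G => (h * c)%g) @^-1` A)).
  apply: bigcup_open => c _; apply: open_cvg_preimage oA => h.
  by apply: (@cvg_mulg _ _ _ (nbhs h) _ id (fun=> c) h c); [exact: cvg_id|exact: cvg_cst].
apply/seteqP; split => h /=.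
  by move=> [a Aa /esym/coset_proj_eq haG]; exists (h^-1 * a)%g; rewrite //= mulgA mulgV mul1g.
by move=> [c cG Ahc]; exists (h * c)%g => //; apply/esym/coset_proj_eq; rewrite mulKg.
Qed.

End group.

Variable mu : probability X R.
Hypothesis hmu : invariant_measure mu.

Lemma gact_measure_preserving (g : G) : measure_preserving mu (gact g).
Proof. by split; [exact: measurable_gact|move=> A mA; exact: hmu]. Qed.

(** The action is transitive, so translates of [A] cover the space; by compactness finitely many
    suffice, and by invariance all of them have measure [mu A]. *)
Lemma open_measure_gt0 (A : set X) : compact [set: X] -> open A -> A !=set0 -> (0 < mu A)%E.
Proof.
move=> cX oA [x Ax]; rewrite lt_def measure_ge0 andbT; apply/negP => /eqP muA.
have := cX; rewrite compact_cover => /(_ G setT (fun g => gact g @^-1` A))[].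
- by move=> g _; exact: open_gact.
- move=> y _; exists (repr x * (repr y)^-1)%g => //=.
  by rewrite -[y in gact _ y]coset_proj_repr gact_coset_proj -mulgA mulVg mulg1 coset_proj_repr.
move=> D _; set K := cover _ _ => DX.
have null : mu.-negligible K.
  rewrite /K /cover bigcup_fset; elim: (finmap.enum_fset D) => [|g s IH].
    by rewrite big_nil; exact: negligible_set0.
  rewrite big_cons; apply: negligibleU => //; apply/negligibleP.
    by apply: open_measurable_homog; exact: open_gact.
  by apply: eq_trans (hmu g A _) muA; exact: open_measurable_homog.
have /negligibleP : mu.-negligible [set: X] by exact: negligibleS null.
by move=> /(_ measurableT); rewrite [X in X = _](probability_setT mu) => /eqP; rewrite onee_eq0.
Qed.

(** Measurable asymptotically fixed sets form a sigma-algebra. It contains the open sets because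
    [gact (g k) x] tends to [x] for each [x], hence all Borel sets. *)
Lemma gact_asymptotically_fixed (g : nat -> G) (C : set X) :
  g k @[k --> \oo] --> (1%g : G) -> measurable C ->
  asymptotically_fixed mu (fun k => gact (g k)) C.
Proof.
move=> g1.
have gmp k := gact_measure_preserving (g k).
suff H : <<s @open X >> `<=` [set C | measurable C /\ asymptotically_fixed mu (fun k => gact (g k)) C].
  by move=> /H[].
apply: smallest_sub; first split => /=.
- split => //; apply: asymptotically_fixed_eventually => //.
- move=> A [mA aA]; rewrite setTD; split; first exact: measurableC.
  exact: asymptotically_fixedC.
- move=> A HA; split; first by apply: bigcupT_measurable => k; exact: (HA k).1.
  by apply: asymptotically_fixed_bigcup => // k; [exact: (HA k).1|exact: (HA k).2].
move=> A oA; have mA := open_measurable_homog _ oA; split => //.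
apply: asymptotically_fixed_eventually => // x Ax.
have := cvg_gact \oo g 1%g x g1; rewrite gact1 => /(_ _ A); apply.
exact: open_nbhs_nbhs.
Qed.

End homogeneous_space.

(** * A local cross-section of the unipotent flow *)

Section cross_section.
Context {R : realType} {n : nat} {Gam : set (SOn1 R n)}.
Local Notation G := (SOn1 R n).
Local Notation X := (homog Gam).
Variable U : 'M[R]_(n + 1).
Hypotheses (hU : son1 R n U) (U3 : U ^+ 3 = 0).
Hypothesis gGam : group_closed (mem Gam).

Local Notation u t := (gexp (t *: U) : G).

Lemma flowE t (x : X) : flow U t x = gact (u t) x.
Proof. by []. Qed.

Lemma flow0 (x : X) : flow U 0 x = x.
Proof. by rewrite flowE gexp0// gact1. Qed.

Lemma flowD s t (x : X) : flow U (s + t) x = flow U s (flow U t x).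
Proof. by rewrite !flowE gexpD// gactM. Qed.

Lemma measurable_orbit (x : X) : measurable_fun setT (fun t : R => flow U t x).
Proof.
apply: (measurability (@open X)) => // _ [A oA <-]; rewrite setTI.
apply: open_measurable; apply: open_cvg_preimage oA => t.
by apply: (@cvg_gact _ _ _ _ (nbhs t) _ (fun t => u t) (u t)); exact: gexp_continuous.
Qed.

Variables (i j : 'I_(n + 1)).
Hypothesis Uij : (U *m U) i j != 0.

(* On the open set where [height_den] does not vanish, [height] increases at
   unit speed along the left action of the one-parameter group of [U]. *)
Definition height_den (g : G) : R := (U *m U *m \val g) i j.
Definition height (g : G) : R := (U *m \val g) i j / height_den g - U i j / (U *m U) i j.

Lemma height_den_flow t (g : G) : height_den (u t * g)%g = height_den g.
Proof.
have U3' : U *m U *m U = 0 by rewrite !mulmxE -expr2 -exprSr.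
rewrite /height_den /= val_gexp// /uexp mulmxA !mulmxDr mulmx1 -!scalemxAr mulmxA.
by rewrite U3' mul0mx !scaler0 !addr0.
Qed.

(** Since [U ^+ 3 = 0], left multiplication by [u t] adds [t *: (U *m U *m \val g)] to [U *m \val g]
    and leaves the denominator unchanged. *)
Lemma height_flow t (g : G) : height_den g != 0 -> height (u t * g)%g = height g + t.
Proof.
move=> g0; have U3' : U *m U *m U = 0 by rewrite !mulmxE -expr2 -exprSr.
have E : (U *m \val (u t * g)%g) i j = (U *m \val g) i j + t * height_den g.
  rewrite /= val_gexp// /uexp mulmxA !mulmxDr mulmx1 -!scalemxAr mulmxA.
  by rewrite U3' scaler0 addr0 mulmxDl -scalemxAl mxE; congr (_ + _); rewrite mxE.
by rewrite /height height_den_flow E; field; rewrite g0 Uij.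
Qed.

Lemma height1 : height 1%g = 0.
Proof. by rewrite /height /height_den /= !mulmx1 subrr. Qed.

Lemma height_den_continuous : continuous height_den.
Proof.
move=> g; apply: (@cvg_coord _ _ _ _ (nbhs g) _ (fun g : G => U *m U *m \val g)).
by apply: cvg_mulmx; [exact: cvg_cst|exact: val_SOn1_continuous].
Qed.

Lemma height_continuous (g : G) : height_den g != 0 -> height h @[h --> g] --> height g.
Proof.
move=> g0; rewrite /height.
apply: (@cvgB _ _ _ (nbhs g) _ (fun h : G => (U *m \val h) i j / height_den h)
  (fun=> U i j / (U *m U) i j)); last exact: cvg_cst.
apply: cvgM; last by apply: cvgV => //; exact: (height_den_continuous g).
apply: (@cvg_coord _ _ _ _ (nbhs g) _ (fun g : G => U *m \val g)).
by apply: cvg_mulmx; [exact: cvg_cst|exact: val_SOn1_continuous].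
Qed.

Definition zero_section (W : set G) : set X := coset_proj @` [set g | W g /\ height g = 0].

(* The time at which the orbit of [g] crosses the section is determined by the
   height, which makes the set of crossing orbits open. *)
Lemma open_zero_section_hits (W : set G) r : open W -> (forall g, W g -> height_den g != 0) ->
  open (hits (flow U) (zero_section W) 0 r).
Proof.
move=> oW W0.
(* Lifts of the crossing points: height grows at unit speed, so level 0 is reached after time
   [- height g]. *)
pose O := [set g : G | [/\ height_den g != 0, 0 < - height g < r & W (u (- height g) * g)%g]].
suff oO : open O.
  rewrite (_ : hits _ _ _ _ = coset_proj @` O); first exact: open_coset_proj_image.
  apply/seteqP; split => [x [t [tr [w [Ww w0] wx]]]|_ [g [g0 gr Wg] <-]].
    have d0 := W0 w Ww.
    have E : height (u (- t) * w)%g = - t by rewrite height_flow// w0 add0r.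
    exists (u (- t) * w)%g.
      split; [by rewrite height_den_flow|by rewrite E opprK|].
      by rewrite E opprK mulgA -gexpD// subrr gexp0// mul1g.
    by rewrite -gact_coset_proj wx -flowE -flowD addNr flow0.
  exists (- height g); split=> //; exists (u (- height g) * g)%g; last by rewrite flowE gact_coset_proj.
  by split => //; rewrite height_flow// subrr.
rewrite openE => g [g0 /andP[gl gr] Wg]; rewrite /interior.
have hc := height_continuous g g0.
have hn : - height h @[h --> g] --> - height g by exact: (cvgN hc).
near=> h; split.
- by near: h; exact: (cvgr_neq0 _ (height_den_continuous g) g0).
- apply/andP; split; near: h; first exact: (cvgr_gt _ hn).
  exact: (cvgr_lt _ hn).
- near: h.
  have : (u (- height h) * h)%g @[h --> g] --> (u (- height g) * g)%g.
    apply: (@cvg_mulg _ _ _ (nbhs g) _ (fun h => u (- height h)) id _ g); last exact: cvg_id.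
    apply: (cvg_comp (fun h => - height h) (fun t => u t) hn).
    exact: gexp_continuous.
  by move=> /(_ W); apply; apply: open_nbhs_nbhs.
Unshelve. all: by end_near. Qed.

(** Discreteness isolates 1 from the rest of [Gam] by a neighbourhood [V]. For [w], [w'] in a small
    [W] and small [t], the element [w'^-1 * (u t * w)] stays in [V]; if the flow carries the coset
    of [w] to that of [w'], it is also in [Gam], hence equal to 1. Comparing heights in
    [w' = u t * w] then gives [t = 0]. *)
Lemma exists_zero_section : isolated Gam = Gam ->
  exists (W : set G) (delta : R),
    [/\ open W, W 1%g, (forall g, W g -> height_den g != 0), 0 < delta &
      forall (x : X) t, zero_section W x -> zero_section W (flow U t x) -> `|t| < delta -> t = 0].
Proof.
move=> isoG; have : isolated Gam 1%g by rewrite isoG; exact: Gam1.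
move=> [_ [V V1 VG]].
have cf : (p.1.1^-1 * (u p.2 * p.1.2))%g @[p --> ((1%g : G), (1%g : G), (0 : R))] --> (1%g : G).
  have E : 1%g = (1%g^-1 * (u 0 * 1%g))%g :> G by rewrite gexp0// invg1 !mul1g.
  rewrite [X in _ --> X]E.
  have c1 : (fun p : G * G * R => p.1.1) @ nbhs ((1%g : G), (1%g : G), (0 : R)) --> (1%g : G).
    by apply: (cvg_comp (fun p : G * G * R => p.1) (fun q : G * G => q.1)); exact: cvg_fst.
  have c2 : (fun p : G * G * R => p.1.2) @ nbhs ((1%g : G), (1%g : G), (0 : R)) --> (1%g : G).
    by apply: (cvg_comp (fun p : G * G * R => p.1) (fun q : G * G => q.2) cvg_fst); exact: cvg_snd.
  apply: (@cvg_mulg _ _ _ (nbhs ((1%g : G), (1%g : G), (0 : R))) _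
      (fun p : G * G * R => p.1.1^-1)%g (fun p => u p.2 * p.1.2)%g).
    exact: (@cvg_invg _ _ _ (nbhs ((1%g : G), (1%g : G), (0 : R))) _
      (fun p : G * G * R => p.1.1)).
  apply: (@cvg_mulg _ _ _ (nbhs ((1%g : G), (1%g : G), (0 : R))) _
      (fun p : G * G * R => u p.2) (fun p => p.1.2)) => //.
  apply: (cvg_comp (fun p : G * G * R => p.2) (fun t => u t) cvg_snd).
  exact: gexp_continuous.
have /= [[A B] [[[A1 A2] [/= nA1 nA2] A12] nB] AB] := cf V V1.
have [d /= d0 dB] := nB.
pose D := [set g : G | height_den g != 0].
exists ((A1 `&` A2 `&` D)°), d; split => //.
- exact: open_interior.
- apply: filterI; first exact: filterI.
  by apply: (cvgr_neq0 _ (height_den_continuous 1%g)); rewrite /height_den mulmx1.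
- by move=> g /interior_subset[].
move=> x t [w [/interior_subset[[A1w A2w] w0] hw] wx] [w' [/interior_subset[[A1w' A2w'] w'0] hw'] wx'] td.
have /coset_proj_eq : coset_proj w' = coset_proj (u t * w)%g :> X by rewrite wx' -gact_coset_proj wx.
move=> /(_ gGam) cG.
have Vc : V (w'^-1 * (u t * w))%g.
  apply: (AB (w', w, t)); split => /=; first by apply: A12.
  by apply: dB; rewrite /= sub0r normrN.
have : [set 1%g] (w'^-1 * (u t * w))%g by rewrite -VG.
move=> /= E; have w'E : w' = (u t * w)%g.
  by rewrite -[LHS]mulg1 -E mulgA mulgV mul1g.
by move: hw'; rewrite w'E height_flow// hw add0r.
Qed.

End cross_section.

(** * A conjugacy would contradict the renormalization *)

Lemma cvg_succ_ratio {R : realType} :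
  (k.*2.+3)%:R / (k.*2.+2)%:R @[k --> \oo] --> (1 : R).
Proof.
rewrite (_ : (fun k => _) = (fun k => 1 + 2^-1 * harmonic k)).
  rewrite -[X in _ --> X]addr0 -[X in _ --> _ + X](mulr0 2^-1).
  by apply: cvgD; [exact: cvg_cst|apply: cvgMr; exact: cvg_harmonic].
apply/funext => k /=.
have -> : k.*2.+3 = (2 * k.+1 + 1)%N by lia.
have -> : k.*2.+2 = (2 * k.+1)%N by lia.
rewrite natrD natrM; by field; rewrite nat1r pnatr_eq0.
Qed.

Theorem corollary1p5 (R : realType) (n : nat) (hn : (3 <= n)%N)
    (Gam : set (SOn1 R n)) (hGam : is_cocompact_lattice Gam)
    (mu : probability (homog Gam) R) (hmu : invariant_measure mu)
    (hDelta : exists lam : R, 0 < lam < 4^-1 /\ laplace_eigenvalue mu lam)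
    (U : 'M[R]_(n + 1)) (hU : son1 R n U) (U0 : U != 0)
    (Unil : nilpotent_mx U) :
  exists tau : homog Gam -> R,
    [/\ forall x, 0 < tau x,
        mu.-integrable [set: homog Gam] (EFin \o tau),
        (\int[mu]_x (tau x)%:E = 1)%E
      & ~ exists psi : homog Gam -> homog Gam,
          measurable_conjugacy mu (time_change_measure mu tau)
            (flow U) (time_change U tau) psi].
Proof.
have [[gGam isoG _] cX] := hGam.
have U3 := son1_nilpotent_cube U hU Unil.
(* A nonzero entry of [U *m U] is the value of [height_den] at the identity. *)
have /matrix0Pn[i [j Uij]] : U *m U != 0.
  by apply: contra_neq U0; exact: skew_sqr0.
have [W [delta [oW W1 W0 delta0 spaced]]] := exists_zero_section U hU U3 gGam i j Uij isoG.
pose phi : R -> homog Gam -> homog Gam := flow U; pose S := zero_section U i j W : set (homog Gam).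
have mflow t : measure_preserving mu (phi t).
  exact: gact_measure_preserving hmu _.
have ohits r : open (hits phi S 0 r).
  exact: (open_zero_section_hits U hU U3 gGam i j Uij W r oW W0).
have hits1 : (0 < mu (hits phi S 0 1))%E.
  apply: open_measure_gt0 => //.
  (* This point reaches the base coset, which lies on the section, at time [2^-1]; the open set is
     therefore nonempty. *)
  exists (coset_proj (gexp (- 2^-1 *: U))), 2^-1; split; first lra.
  exists 1%g; first by split => //; exact: height1.
  by rewrite /phi flowE gact_coset_proj -gexpD// subrr gexp0.
have [tau [h [B [Y [[tau0 mtau itau tau1] [mB mY BY Y0] Yflow Bswap]]]]] :=
  exists_antiperiodic_time_change mu phi S delta
    (flow0 U hU U3) (flowD U hU U3) mflow (measurable_orbit U hU U3) delta0 spaced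
    (fun r => open_measurable_homog _ (ohits r)) 1 hits1.
exists tau; split => // -[psi [[mpsi psimu _] /(_ h) conj]].
have [dil [dilU dil1]] := SOn1_renormalization U hU U3 Unil U0.
have mZ : measurable (psi @^-1` Y) by rewrite -[X in measurable X]setTI; exact: mpsi.
have mC : measurable (psi @^-1` B) by rewrite -[X in measurable X]setTI; exact: mpsi.
have : mu (psi @^-1` Y) = 0%E.
  (* The conjugacy at time [h] transports the swap of [B] inside [Y] under the time change to a swap
     of their preimages under the unperturbed flow. *)
  apply: (no_antiperiodic_set mu phi
    (fun k => gact (dil ((k.*2.+3)%:R / (k.*2.+2)%:R))) h (psi @^-1` B)) => //.
  - by move=> k; exact: gact_measure_preserving hmu _.
  - exact: flow0.
  - exact: flowD.
  - by move=> k t x; rewrite /phi !flowE -!gactM dilU// divr_gt0.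
  - by move=> x; exact: BY.
  - apply: gact_asymptotically_fixed => //.
    exact: (cvg_comp _ dil cvg_succ_ratio dil1).
  apply: filterS conj => x; rewrite /time_change -[xi U tau]/(clock phi tau) => E.
  rewrite /= E; set t := xget _ _; split.
  - by move=> Bx; have Yx := BY _ Bx; split; [exact/Yflow|exact/(Bswap _ Yx)].
  - by move=> [Yx nBx]; apply: contrapT => /(Bswap _ Yx).
  - by move=> nY /Yflow.
(* As [psi] carries [mu] to the measure of density [tau], the set [Y] would be null for the latter,
   although [tau] is positive and [mu Y > 0]. *)
rewrite psimu// => tauY; suff : (0 < time_change_measure mu tau Y)%E by rewrite tauY ltxx.
apply: integral_gt0 => //; exact: measurable_funTS.
Qed.
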